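(* For every $\Sigma^B_0$ formula $\varphi(i,Y)$, the instances of the axiom $(\Sigma^B_0\text{-}\mathrm{ID})$ for $\varphi$ are provable in $W^1_1$ when the predicate $P_\varphi$ is replaced by its $W^1_1$-definition; that is, $W^1_1$ proves $$\forall x\,(\exists U,V\le x+1)\big[V\ne\emptyset\wedge (P^{U+V}_{\varphi,x}=P^U_{\varphi,x})\big],$$ where $P^X_{\varphi,x}$ denotes $P^X_{\varphi,x}[\emptyset]$ and, for strings $X,Y,Z$, the relation $P^X_{\varphi,x}[Y]=Z$ is expressed by the formula asserting the existence of a hyper string $\mathcal Z$ such that $(\mathcal Z)^\emptyset=Y$, $(\mathcal Z)^X=Z$, $|(\mathcal Z)^U|\le x$ for all strings $U\le X$, and $(\forall i<x)[(\mathcal Z)^{S(U)}(i)\leftrightarrow\varphi(i,(\mathcal Z)^U)]$ for all strings $U<X$.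
   Context: Third order bounded arithmetic (Skelley). The vocabulary $\mathcal L^3_A$ extends the two-sorted Cook–Nguyen vocabulary $\mathcal L^2_A$ (numbers; strings = finite subsets of $\mathbb N$, identified with binary numbers $\sum_{i\in X}2^i$; string length $|X|$; $X(t)$ means $t\in X$) by hyper string variables $\mathcal X,\mathcal Y,\mathcal Z,\dots$ (sets of strings) and a membership relation $\mathcal X(Y)$. $(\exists X\le t)$ means $\exists X(|X|\le t\wedge\cdot)$. $\Sigma^B_0$: $\mathcal L^2_A$-formulas with only bounded number quantifiers. $\Sigma^{\mathcal B}_0$: $\mathcal L^3_A$-formulas with no third-order quantifiers and only bounded second-order and number quantifiers; $\Sigma^{\mathcal B}_1$: formulas $\exists\mathcal X\psi$ with $\psi\in\Sigma^{\mathcal B}_0$. $W^1_1$ consists of the basic axioms B1–B12, L1, L2, SE, $\Sigma^{\mathcal B}_1$-induction, $\Sigma^{\mathcal B}_0$-comprehension for strings, and third order comprehension $\forall x\exists\mathcal Z(\forall Y\le x)[\mathcal Z(Y)\leftrightarrow\varphi(Y)]$ for $\varphi\in\Sigma^{\mathcal B}_0$; $\Sigma^B_0$-definable string functions are available: $\emptyset$, string successor $S(X)$ (binary $X+1$), string addition $X+Y$, string ordering $X<Y$ (binary values), string pairing $\langle X_0,X_1\rangle$ (with $\langle X_0,X_1\rangle(i)\leftrightarrow(\exists j\le i)[(i=\langle0,j\rangle\wedge X_0(j))\vee(i=\langle1,j\rangle\wedge X_1(j))]$, $\langle x,y\rangle=(x+y)(x+y+1)+2y$). For a hyper string $\mathcal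 Z$, $(\mathcal Z)^X=Y$ abbreviates $\mathcal Z(\langle X,Y\rangle)$. *)

(* Defs.v *)
From Stdlib Require Import List.
Import ListNotations.

(** De Bruijn indices, with one independent index space per sort: a quantifier
    over one sort does not move the indices of the other two.  The only terms of
    the string and hyper string sorts are variables, so these are plain [nat]s.
    Suffixes 1, 2, 3 refer to numbers, strings and hyper strings. *)

Inductive tm : Type :=
| TVar (n : nat)
| TZero
| TOne
| TAdd (t u : tm)
| TMul (t u : tm)
| TLen (X : nat).

Inductive fm : Type :=
| FBot
| FEq1 (t u : tm)
| FEq2 (X Y : nat)
| FLe (t u : tm)
| FIn2 (X : nat) (t : tm)        (* X(t) *)
| FIn3 (Z : nat) (Y : nat)       (* Z(Y), Z a hyper string *)
| FImp (A B : fm)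
| FAnd (A B : fm)
| FOr (A B : fm)
| FAll1 (A : fm) | FEx1 (A : fm)
| FAll2 (A : fm) | FEx2 (A : fm)
| FAll3 (A : fm) | FEx3 (A : fm).

Declare Scope tm_scope.
Delimit Scope tm_scope with T.
Bind Scope tm_scope with tm.
Declare Scope fm_scope.
Delimit Scope fm_scope with F.
Bind Scope fm_scope with fm.

Notation "0" := TZero : tm_scope.
Notation "1" := TOne : tm_scope.
Notation "t + u" := (TAdd t u) : tm_scope.
Notation "t * u" := (TMul t u) : tm_scope.

Definition FNot (A : fm) : fm := FImp A FBot.
Definition FIff (A B : fm) : fm := FAnd (FImp A B) (FImp B A).
Definition FLt (t u : tm) : fm := FAnd (FLe t u) (FNot (FEq1 t u)).

Notation "~ A" := (FNot A) : fm_scope.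
Notation "A /\ B" := (FAnd A B) : fm_scope.
Notation "A \/ B" := (FOr A B) : fm_scope.
Notation "A -> B" := (FImp A B) : fm_scope.
Notation "A <-> B" := (FIff A B) : fm_scope.
Notation "t = u" := (FEq1 t u) : fm_scope.
Notation "t <= u" := (FLe t u) : fm_scope.
Notation "t < u" := (FLt t u) : fm_scope.

Definition scons {A : Type} (a : A) (s : nat -> A) (n : nat) : A :=
  match n with O => a | S m => s m end.

Definition rid (n : nat) : nat := n.
Definition rup (r : nat -> nat) : nat -> nat := scons O (fun n => S (r n)).

Fixpoint tsubst (s1 : nat -> tm) (r2 : nat -> nat) (t : tm) : tm :=
  match t with
  | TVar n => s1 n
  | TZero => TZero
  | TOne => TOne
  | TAdd t u => TAdd (tsubst s1 r2 t) (tsubst s1 r2 u)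
  | TMul t u => TMul (tsubst s1 r2 t) (tsubst s1 r2 u)
  | TLen X => TLen (r2 X)
  end.

Definition shift1 (n : nat) : tm := TVar (S n).

Definition tlift1 : tm -> tm := tsubst shift1 rid.
Definition tlift2 : tm -> tm := tsubst TVar S.

Definition sup1 (s : nat -> tm) : nat -> tm :=
  scons (TVar O) (fun n => tlift1 (s n)).

Fixpoint fsubst (s1 : nat -> tm) (r2 r3 : nat -> nat) (A : fm) : fm :=
  match A with
  | FBot => FBot
  | FEq1 t u => FEq1 (tsubst s1 r2 t) (tsubst s1 r2 u)
  | FEq2 X Y => FEq2 (r2 X) (r2 Y)
  | FLe t u => FLe (tsubst s1 r2 t) (tsubst s1 r2 u)
  | FIn2 X t => FIn2 (r2 X) (tsubst s1 r2 t)
  | FIn3 Z Y => FIn3 (r3 Z) (r2 Y)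
  | FImp A B => FImp (fsubst s1 r2 r3 A) (fsubst s1 r2 r3 B)
  | FAnd A B => FAnd (fsubst s1 r2 r3 A) (fsubst s1 r2 r3 B)
  | FOr A B => FOr (fsubst s1 r2 r3 A) (fsubst s1 r2 r3 B)
  | FAll1 A => FAll1 (fsubst (sup1 s1) r2 r3 A)
  | FEx1 A => FEx1 (fsubst (sup1 s1) r2 r3 A)
  | FAll2 A => FAll2 (fsubst (fun n => tlift2 (s1 n)) (rup r2) r3 A)
  | FEx2 A => FEx2 (fsubst (fun n => tlift2 (s1 n)) (rup r2) r3 A)
  | FAll3 A => FAll3 (fsubst s1 r2 (rup r3) A)
  | FEx3 A => FEx3 (fsubst s1 r2 (rup r3) A)
  end.

Definition lift1 : fm -> fm := fsubst shift1 rid rid.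
Definition lift2 : fm -> fm := fsubst TVar S rid.
Definition lift3 : fm -> fm := fsubst TVar rid S.

Definition inst1 (t : tm) : fm -> fm := fsubst (scons t TVar) rid rid.
Definition inst2 (X : nat) : fm -> fm := fsubst TVar (scons X rid) rid.
Definition inst3 (Z : nat) : fm -> fm := fsubst TVar rid (scons Z rid).

(** The bound is given outside the scope of the quantifier, hence the lifting. *)

Definition all_le (t : tm) (A : fm) : fm := FAll1 (TVar O <= tlift1 t -> A).
Definition ex_le (t : tm) (A : fm) : fm := FEx1 (TVar O <= tlift1 t /\ A).
Definition all_lt (t : tm) (A : fm) : fm := all_le t (TVar O < tlift1 t -> A).
Definition ex_lt (t : tm) (A : fm) : fm := ex_le t (TVar O < tlift1 t /\ A).

Definition all2_le (t : tm) (A : fm) : fm := FAll2 (TLen O <= tlift2 t -> A).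
Definition ex2_le (t : tm) (A : fm) : fm := FEx2 (TLen O <= tlift2 t /\ A).

(** [SigmaB0] lies in the two-sorted language: hyper string atoms are excluded.
    Free variables are unrestricted. *)

Inductive SigmaB0 : fm -> Prop :=
| SB0_bot : SigmaB0 FBot
| SB0_eq1 t u : SigmaB0 (FEq1 t u)
| SB0_eq2 X Y : SigmaB0 (FEq2 X Y)
| SB0_le t u : SigmaB0 (FLe t u)
| SB0_in2 X t : SigmaB0 (FIn2 X t)
| SB0_imp A B : SigmaB0 A -> SigmaB0 B -> SigmaB0 (FImp A B)
| SB0_and A B : SigmaB0 A -> SigmaB0 B -> SigmaB0 (FAnd A B)
| SB0_or A B : SigmaB0 A -> SigmaB0 B -> SigmaB0 (FOr A B)
| SB0_all t A : SigmaB0 A -> SigmaB0 (all_le t A)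
| SB0_ex t A : SigmaB0 A -> SigmaB0 (ex_le t A).

Inductive SigmaBB0 : fm -> Prop :=
| SBB0_bot : SigmaBB0 FBot
| SBB0_eq1 t u : SigmaBB0 (FEq1 t u)
| SBB0_eq2 X Y : SigmaBB0 (FEq2 X Y)
| SBB0_le t u : SigmaBB0 (FLe t u)
| SBB0_in2 X t : SigmaBB0 (FIn2 X t)
| SBB0_in3 Z Y : SigmaBB0 (FIn3 Z Y)
| SBB0_imp A B : SigmaBB0 A -> SigmaBB0 B -> SigmaBB0 (FImp A B)
| SBB0_and A B : SigmaBB0 A -> SigmaBB0 B -> SigmaBB0 (FAnd A B)
| SBB0_or A B : SigmaBB0 A -> SigmaBB0 B -> SigmaBB0 (FOr A B)
| SBB0_all1 t A : SigmaBB0 A -> SigmaBB0 (all_le t A)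
| SBB0_ex1 t A : SigmaBB0 A -> SigmaBB0 (ex_le t A)
| SBB0_all2 t A : SigmaBB0 A -> SigmaBB0 (all2_le t A)
| SBB0_ex2 t A : SigmaBB0 A -> SigmaBB0 (ex2_le t A).

Inductive SigmaBB1 : fm -> Prop :=
| SBB1_ex3 A : SigmaBB0 A -> SigmaBB1 (FEx3 A).

(** Natural deduction for classical three-sorted logic with equality on numbers
    and on strings.  Non-logical axioms may have free variables; since [P_ax]
    applies in every context and the generalization rules shift the context but
    not [T], an axiom stands for its universal closure. *)

Inductive prv (T : fm -> Prop) : list fm -> fm -> Prop :=
| P_ax G A : T A -> prv T G A
| P_hyp G A : In A G -> prv T G A
| P_raa G A : prv T (FNot A :: G) FBot -> prv T G A
| P_impI G A B : prv T (A :: G) B -> prv T G (FImp A B)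
| P_impE G A B : prv T G (FImp A B) -> prv T G A -> prv T G B
| P_andI G A B : prv T G A -> prv T G B -> prv T G (FAnd A B)
| P_andE1 G A B : prv T G (FAnd A B) -> prv T G A
| P_andE2 G A B : prv T G (FAnd A B) -> prv T G B
| P_orI1 G A B : prv T G A -> prv T G (FOr A B)
| P_orI2 G A B : prv T G B -> prv T G (FOr A B)
| P_orE G A B C :
    prv T G (FOr A B) -> prv T (A :: G) C -> prv T (B :: G) C -> prv T G C
| P_all1I G A : prv T (map lift1 G) A -> prv T G (FAll1 A)
| P_all1E G A t : prv T G (FAll1 A) -> prv T G (inst1 t A)
| P_ex1I G A t : prv T G (inst1 t A) -> prv T G (FEx1 A)
| P_ex1E G A B :
    prv T G (FEx1 A) -> prv T (A :: map lift1 G) (lift1 B) -> prv T G B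
| P_all2I G A : prv T (map lift2 G) A -> prv T G (FAll2 A)
| P_all2E G A X : prv T G (FAll2 A) -> prv T G (inst2 X A)
| P_ex2I G A X : prv T G (inst2 X A) -> prv T G (FEx2 A)
| P_ex2E G A B :
    prv T G (FEx2 A) -> prv T (A :: map lift2 G) (lift2 B) -> prv T G B
| P_all3I G A : prv T (map lift3 G) A -> prv T G (FAll3 A)
| P_all3E G A Z : prv T G (FAll3 A) -> prv T G (inst3 Z A)
| P_ex3I G A Z : prv T G (inst3 Z A) -> prv T G (FEx3 A)
| P_ex3E G A B :
    prv T G (FEx3 A) -> prv T (A :: map lift3 G) (lift3 B) -> prv T G B
| P_eq1_refl G t : prv T G (FEq1 t t)
| P_eq1_subst G A t u :
    prv T G (FEq1 t u) -> prv T G (inst1 t A) -> prv T G (inst1 u A)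
| P_eq2_refl G X : prv T G (FEq2 X X)
| P_eq2_subst G A X Y :
    prv T G (FEq2 X Y) -> prv T G (inst2 X A) -> prv T G (inst2 Y A).

Definition provable (T : fm -> Prop) (A : fm) : Prop := prv T [] A.

Local Notation x := (TVar 0).
Local Notation y := (TVar 1).

Inductive BASIC : fm -> Prop :=
| B1 : BASIC (~ x + 1 = 0)
| B2 : BASIC (x + 1 = y + 1 -> x = y)
| B3 : BASIC (x + 0 = x)
| B4 : BASIC (x + (y + 1) = (x + y) + 1)
| B5 : BASIC (x * 0 = 0)
| B6 : BASIC (x * (y + 1) = x * y + x)
| B7 : BASIC (x <= y /\ y <= x -> x = y)
| B8 : BASIC (x <= x + y)
| B9 : BASIC (0 <= x)
| B10 : BASIC (x <= y \/ y <= x)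
| B11 : BASIC (x <= y <-> x < y + 1)
| B12 : BASIC (~ x = 0 -> ex_le x (TVar 0 + 1 = TVar 1))
| L1 : BASIC (FIn2 0 x -> x < TLen 0)
| L2 : BASIC (x + 1 = TLen 0 -> FIn2 0 x)
| SE : BASIC (TLen 0 = TLen 1
              /\ all_lt (TLen 0) (FIn2 0 (TVar 0) <-> FIn2 1 (TVar 0))
              -> FEq2 0 1).

(** Induction on the number variable 0 of [A]. *)
Definition IND (A : fm) : fm :=
  inst1 TZero A
  /\ FAll1 (A -> fsubst (scons (TVar 0 + 1)%T shift1) rid rid A)
  -> FAll1 A.

(** In [A], number variable 0 is the element z and number variable 1 the bound y. *)
Definition COMP2 (A : fm) : fm :=
  FAll1 (ex2_le (TVar 0)
    (all_lt (TVar 0) (FIn2 0 (TVar 0) <-> lift2 A))).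

(** In [A], string variable 0 is the element Y and number variable 0 the bound x. *)
Definition COMP3 (A : fm) : fm :=
  FAll1 (FEx3 (all2_le (TVar 0) (FIn3 0 0 <-> lift3 A))).

Inductive W11 : fm -> Prop :=
| W11_BASIC A : BASIC A -> W11 A
| W11_IND A : SigmaBB1 A -> W11 (IND A)
| W11_COMP2 A : SigmaBB0 A -> W11 (COMP2 A)
| W11_COMP3 A : SigmaBB0 A -> W11 (COMP3 A).

(** W^1_1 has no symbols for string functions.  A function given by
    F(X..)(i) <-> i < t /\ B(i,X..) is represented by its graph: W = F(X..) iff
    |W| <= t and W(i) <-> B(i,X..) for all i < t.  An occurrence of a function
    term in a formula is eliminated by an existential quantifier over its value. *)

(** Number variable 0 of [B] is the position of the bit. *)
Definition bitgraph (W : nat) (t : tm) (B : fm) : fm :=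
  TLen W <= t /\ all_lt t (FIn2 W (TVar 0) <-> B).

Definition is_empty (W : nat) : fm := TLen W = 0.

Definition is_succ (W X : nat) : fm :=
  bitgraph W (TLen X + 1)
    (FIn2 X (TVar 0) /\ ex_lt (TVar 0) (~ FIn2 X (TVar 0))
     \/ ~ FIn2 X (TVar 0) /\ all_lt (TVar 0) (FIn2 X (TVar 0))).

Definition FXor (A B : fm) : fm := A /\ ~ B \/ ~ A /\ B.

(** The carry into position i = number variable 0; below, k and j are bound. *)
Definition carry (X Y : nat) : fm :=
  ex_lt (TVar 0)                                          (* k < i *)
    (FIn2 X (TVar 0) /\ FIn2 Y (TVar 0)
     /\ all_lt (TVar 1)                                   (* j < i *)
          (TVar 1 < TVar 0 -> FIn2 X (TVar 0) \/ FIn2 Y (TVar 0))).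

Definition is_add (W X Y : nat) : fm :=
  bitgraph W (TLen X + TLen Y)
    (FXor (FXor (FIn2 X (TVar 0)) (FIn2 Y (TVar 0))) (carry X Y)).

Definition npair (t u : tm) : tm := ((t + u) * (t + u + 1) + (1 + 1) * u)%T.

(** The bits of the pair are below the pairing of 1 with |X0| + |X1|. *)
Definition is_pair (W X0 X1 : nat) : fm :=
  bitgraph W (npair 1 (TLen X0 + TLen X1))
    (ex_le (TVar 0)
       (TVar 1 = npair 0 (TVar 0) /\ FIn2 X0 (TVar 0)
        \/ TVar 1 = npair 1 (TVar 0) /\ FIn2 X1 (TVar 0))).

(** Order of binary values: at the highest position where X and Y differ, the
    bit of Y is set. *)
Definition FSlt (X Y : nat) : fm :=
  ex_lt (TLen Y)
    (FIn2 Y (TVar 0) /\ ~ FIn2 X (TVar 0)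
     /\ all_lt (TLen X + TLen Y)
          (TVar 1 < TVar 0 -> (FIn2 X (TVar 0) <-> FIn2 Y (TVar 0)))).

Definition FSle (X Y : nat) : fm := FEq2 X Y \/ FSlt X Y.

(** Quantifiers over the strings binary-below X, which have length at most |X|. *)
Definition all_sle (X : nat) (A : fm) : fm := all2_le (TLen X) (FSle 0 (S X) -> A).
Definition all_slt (X : nat) (A : fm) : fm := all2_le (TLen X) (FSlt 0 (S X) -> A).

(** The hyper string Z takes value V at U, with |V| <= t.  Z is constrained by
    comprehension only on strings of bounded length, so "the value of Z at U" can
    only mean the value of length at most t. *)
Definition hval (t : tm) (Z U V : nat) : fm :=
  TLen V <= t /\ FEx2 (is_pair 0 (S U) (S V) /\ FIn3 Z 0).

(** [phi] is phi(i,Y) with i = number variable 0 and Y = string variable 0;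
    its number variable n+1 and string variable m+1 are the parameters number n
    and number m of the sort concerned.

    [Pdef phi] expresses P^X_{phi,x}[Y] = Z, with free variables x = number
    variable 0 and X, Y, Z = string variables 0, 1, 2; the parameters of [phi]
    become number variables n+1 and string variables m+3. *)
Definition Pdef (phi : fm) : fm :=
  FEx3
    (FEx2 (is_empty 0 /\ hval x 0 0 2)                  (* value Y at the empty string *)
     /\ hval x 0 0 2                                    (* value Z at X *)
     /\ all_sle 0                                       (* a unique value at each U <= X *)
          (FEx2 (hval x 0 1 0)
           /\ FAll2 (FAll2 (hval x 0 2 1 /\ hval x 0 2 0 -> FEq2 1 0)))
     /\ all_slt 0                                       (* U < X *)
          (FEx2 (is_succ 0 1 /\                         (* 0 is S(U), 1 is U *)
           FAll2 (FAll2                                 (* 0, 1 are values at S(U), U *)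
             (hval x 0 3 1 /\ hval x 0 2 0 ->
              all_lt x
                (FIn2 0 (TVar 0)
                 <-> fsubst (scons (TVar 0) (fun n => TVar (2 + n)))
                            (scons 1 (fun m => 7 + m)) rid phi)))))).

(** The instance for [phi] of the axiom, with P_phi replaced by its definition;
    free number variable n and string variable m of this formula are the parameters
    number n and number m of [phi]. *)
Definition ID (phi : fm) : fm :=
  let P X Y Z :=
    fsubst TVar (scons X (scons Y (scons Z (fun m => 5 + m)))) rid (Pdef phi) in
  FAll1
    (ex2_le (x + 1) (ex2_le (x + 1)                     (* U, then V *)
      (~ is_empty 0
       /\ FEx2 (FEx2 (FEx2                              (* E, W, then Z *)
            (is_empty 2 /\ is_add 1 4 3                 (* W = U + V *)
             /\ P 1 2 0 /\ P 4 2 0)))))).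

(* Main.v *)
Require Import Defs.
From Stdlib Require Import List Arith Lia Ring Cantor.
From Stdlib Require Import Classical ClassicalEpsilon ProofIrrelevance.
From Stdlib Require Import FunctionalExtensionality PropExtensionality.
Import ListNotations.

(** By the completeness theorem for the calculus it suffices to argue in an arbitrary
    three-sorted structure satisfying W^1_1.

    Let [F] be the map [Y |-> {i < x : phi(i,Y)}] on strings of length at most [x].
    Induction is available on numbers only, so the iterates of [F] are obtained by
    doubling: a single hyper string holds the relation "the [U]-th iterate of [F] at [Y]
    is [V]" for all [Y] and all [U < 2^k], and it is extended to [U < 2^(k+1)] by
    [F^(2^k + L) = F^L o F o F^(2^k - 1)].

    It remains to see that [U |-> F^U(0)] is not injective on the strings of length at
    most [x + 1].  Counting is avoided as follows.  An injection of [2^(x+1)] into [2^x]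
    yields a surjection [V |-> (b V, H V)] of [2^x] onto [2 * 2^x].  Induction on [k],
    concatenating two halves, then shows that any hyper string restricted to an interval of
    [2^k] strings is read off as the bits [b (H^U V)], [U < 2^k], from some [V].  For
    [k = x] this fails for the diagonal hyper string [U |-> ~ b (H^U U)].

    A collision at [U < U'] gives [V = U' - U], computed by borrowing. *)

(** * Substitution *)

(** This forces the relation of iterates to cover every starting point [Y] at once: the second half
    of a run begins wherever the first half ended. It also explains the shape of the composition: at
    stage [k] the exponents of length at most [k] are known, the largest being 2^k - 1, while 2^k
    itself already has length k + 1. Hence the single application of [F] between the halves.

    The pigeonhole argument is amplification followed by Cantor's diagonal. A map that saves one
    bit, iterated 2^x times, would pack any 2^x bits into x bits. Every predicate involved is
    bounded, so the argument stays within the available induction, and the sizes of sets never have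
    to be compared. *)

Lemma tsubst_comp s1 r2 s1' r2' t :
  tsubst s1 r2 (tsubst s1' r2' t)
  = tsubst (fun n => tsubst s1 r2 (s1' n)) (fun n => r2 (r2' n)) t.
Proof. induction t; simpl; try reflexivity; rewrite ?IHt1, ?IHt2; reflexivity. Qed.

Lemma tsubst_id t : tsubst TVar rid t = t.
Proof. induction t; simpl; try reflexivity; rewrite ?IHt1, ?IHt2; reflexivity. Qed.

Lemma sup1_comp s1 r2 s1' :
  (fun n => tsubst (sup1 s1) r2 (sup1 s1' n)) = sup1 (fun n => tsubst s1 r2 (s1' n)).
Proof.
  extensionality n; destruct n as [|n]; simpl; [reflexivity|].
  unfold tlift1; rewrite !tsubst_comp; reflexivity.
Qed.

Lemma lift2_comp s1 r2 (s1' : nat -> tm) :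
  (fun n => tsubst (fun m => tlift2 (s1 m)) (rup r2) (tlift2 (s1' n)))
  = (fun n => tlift2 (tsubst s1 r2 (s1' n))).
Proof. extensionality n; unfold tlift2; rewrite !tsubst_comp; reflexivity. Qed.

Lemma rup_comp r r' : (fun n => rup r (rup r' n)) = rup (fun n => r (r' n)).
Proof. extensionality n; destruct n; reflexivity. Qed.

Lemma fsubst_comp A : forall s1 r2 r3 s1' r2' r3',
  fsubst s1 r2 r3 (fsubst s1' r2' r3' A)
  = fsubst (fun n => tsubst s1 r2 (s1' n)) (fun n => r2 (r2' n)) (fun n => r3 (r3' n)) A.
Proof.
  induction A; intros; simpl; rewrite ?tsubst_comp;
    first [ reflexivity | rewrite IHA1, IHA2; reflexivity
          | rewrite IHA, ?sup1_comp, ?lift2_comp, ?rup_comp; reflexivity ].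
Qed.

Lemma sup1_id : sup1 TVar = TVar.
Proof. extensionality n; destruct n; reflexivity. Qed.

Lemma rup_id : rup rid = rid.
Proof. extensionality n; destruct n; reflexivity. Qed.

Lemma fsubst_id A : fsubst TVar rid rid A = A.
Proof.
  induction A; simpl; rewrite ?tsubst_id, ?sup1_id, ?rup_id;
    first [ reflexivity | rewrite IHA1, IHA2; reflexivity
          | f_equal; exact IHA ].
Qed.

(** Composites collapse to a single substitution, so an identity between them is checked variable by
    variable. A side that is a bare formula is first written as the identity substitution applied to
    it. *)
Ltac fsubst_tac :=
  unfold inst1, inst2, inst3, lift1, lift2, lift3; rewrite ?fsubst_comp;
  try lazymatch goal with
      | |- fsubst _ _ _ _ = _ => idtac
      | |- ?A = _ => transitivity (fsubst TVar rid rid A); [symmetry; apply fsubst_id |]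
      end;
  f_equal;
  let n := fresh "n" in
  extensionality n; try destruct n; simpl; unfold tlift1, tlift2, shift1, rid;
  rewrite ?tsubst_comp; simpl;
  first [ reflexivity | apply tsubst_id | symmetry; apply tsubst_id ].

(** * Variables on which a formula can depend *)

Fixpoint tbound (t : tm) : nat :=
  match t with
  | TVar n => S n
  | TZero | TOne => 0
  | TAdd t u | TMul t u => max (tbound t) (tbound u)
  | TLen X => S X
  end.

(** Variables at or above [fbound A] are not free in [A], in any of the sorts. *)
Fixpoint fbound (A : fm) : nat :=
  match A with
  | FBot => 0
  | FEq1 t u | FLe t u => max (tbound t) (tbound u)
  | FEq2 X Y => max (S X) (S Y)
  | FIn2 X t => max (S X) (tbound t)
  | FIn3 Z Y => max (S Z) (S Y)
  | FImp A B | FAnd A B | FOr A B => max (fbound A) (fbound B)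
  | FAll1 A | FEx1 A | FAll2 A | FEx2 A | FAll3 A | FEx3 A => fbound A
  end.

Definition agree {A : Type} (n : nat) (s s' : nat -> A) : Prop :=
  forall i, i < n -> s i = s' i.

Lemma agree_le {A : Type} m n (s s' : nat -> A) : m <= n -> agree n s s' -> agree m s s'.
Proof. unfold agree; intros; apply H0; lia. Qed.

Lemma agree_sup1 n s s' : agree n s s' -> agree (S n) (sup1 s) (sup1 s').
Proof. intros H [|i] Hi; simpl; [reflexivity | rewrite H; [reflexivity | lia]]. Qed.

Lemma agree_rup n r r' : agree n r r' -> agree (S n) (rup r) (rup r').
Proof. intros H [|i] Hi; simpl; [reflexivity | rewrite H; [reflexivity | lia]]. Qed.

Lemma agree_tlift2 n s s' :
  agree n s s' -> agree n (fun i => tlift2 (s i)) (fun i => tlift2 (s' i)).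
Proof. intros H i Hi; simpl; rewrite H; auto. Qed.

Lemma tsubst_agree t : forall s1 s1' r2 r2',
  agree (tbound t) s1 s1' -> agree (tbound t) r2 r2' -> tsubst s1 r2 t = tsubst s1' r2' t.
Proof.
  induction t; intros; simpl in *; try reflexivity.
  - apply H; lia.
  - f_equal; [apply IHt1 | apply IHt2]; eapply agree_le; try eassumption; lia.
  - f_equal; [apply IHt1 | apply IHt2]; eapply agree_le; try eassumption; lia.
  - f_equal; apply H0; lia.
Qed.

(** Since [fbound] is not lowered at a binder, the agreement under the binder, which reaches one
    index further, only has to be weakened. *)
Lemma fsubst_agree A : forall s1 s1' r2 r2' r3 r3',
  agree (fbound A) s1 s1' -> agree (fbound A) r2 r2' -> agree (fbound A) r3 r3' ->
  fsubst s1 r2 r3 A = fsubst s1' r2' r3' A.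
Proof.
  induction A; intros; cbn [fbound fsubst] in *;
    try reflexivity; f_equal;
    first [ apply tsubst_agree; eapply agree_le; try eassumption; lia
          | match goal with h : agree _ ?r ?r' |- ?r _ = ?r' _ => apply h; lia end
          | first [apply IHA | apply IHA1 | apply IHA2];
            first [ apply agree_tlift2; eapply agree_le; try eassumption; lia
                  | eapply agree_le;
                    [| first [ eassumption | apply agree_sup1; eassumption
                             | apply agree_rup; eassumption ] ]; lia ] ].
Qed.

(** * Derivations *)

Section Derivations.

Variable T : fm -> Prop.

Lemma prv_weaken G G' A : prv T G A -> incl G G' -> prv T G' A.
Proof.
  intros H; revert G'; induction H; intros G' HG.
  - apply P_ax; assumption.
  - apply P_hyp, HG; assumption.
  - apply P_raa, IHprv, incl_cons; [left; reflexivity | apply incl_tl; assumption].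
  - apply P_impI, IHprv, incl_cons; [left; reflexivity | apply incl_tl; assumption].
  - eapply P_impE; eauto.
  - apply P_andI; eauto.
  - eapply P_andE1; eauto.
  - eapply P_andE2; eauto.
  - apply P_orI1; eauto.
  - apply P_orI2; eauto.
  - eapply P_orE; [eauto | apply IHprv2 | apply IHprv3];
      (apply incl_cons; [left; reflexivity | apply incl_tl; assumption]).
  - apply P_all1I, IHprv, incl_map; assumption.
  - apply P_all1E; eauto.
  - eapply P_ex1I; eauto.
  - eapply P_ex1E; [eauto | apply IHprv2].
    apply incl_cons; [left; reflexivity | apply incl_tl, incl_map; assumption].
  - apply P_all2I, IHprv, incl_map; assumption.
  - apply P_all2E; eauto.
  - eapply P_ex2I; eauto.
  - eapply P_ex2E; [eauto | apply IHprv2].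
    apply incl_cons; [left; reflexivity | apply incl_tl, incl_map; assumption].
  - apply P_all3I, IHprv, incl_map; assumption.
  - apply P_all3E; eauto.
  - eapply P_ex3I; eauto.
  - eapply P_ex3E; [eauto | apply IHprv2].
    apply incl_cons; [left; reflexivity | apply incl_tl, incl_map; assumption].
  - apply P_eq1_refl.
  - eapply P_eq1_subst; eauto.
  - apply P_eq2_refl.
  - eapply P_eq2_subst; eauto.
Qed.

(** A simultaneous substitution is obtained one variable at a time: generalize variable 0,
    substitute for the others by induction, then instantiate. The number [n] bounds how many
    variables matter, so the process ends. *)
Lemma prv_inst1_all n : forall A,
  (forall s s', agree n s s' -> fsubst s rid rid A = fsubst s' rid rid A) ->
  prv T [] A -> forall s, prv T [] (fsubst s rid rid A).
Proof.
  induction n as [|n IH]; intros A HA H s.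
  - rewrite (HA s TVar), fsubst_id; [assumption | intros i Hi; lia].
  - apply (P_all1I T []) in H.
    apply IH with (s := fun n => s (S n)) in H.
    + apply P_all1E with (t := s 0) in H.
      replace (fsubst s rid rid A) with
        (inst1 (s 0) (fsubst (sup1 (fun n => s (S n))) rid rid A)); [exact H|].
      fsubst_tac.
    + intros s1 s2 Hs; simpl; f_equal; apply HA, agree_sup1, Hs.
Qed.

Lemma prv_inst2_all n : forall A,
  (forall r r', agree n r r' -> fsubst TVar r rid A = fsubst TVar r' rid A) ->
  prv T [] A -> forall r, prv T [] (fsubst TVar r rid A).
Proof.
  induction n as [|n IH]; intros A HA H r.
  - rewrite (HA r rid), fsubst_id; [assumption | intros i Hi; lia].
  - apply (P_all2I T []) in H.
    apply IH with (r := fun n => r (S n)) in H.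
    + apply P_all2E with (X := r 0) in H.
      replace (fsubst TVar r rid A) with
        (inst2 (r 0) (fsubst TVar (rup (fun n => r (S n))) rid A)); [exact H|].
      fsubst_tac.
    + intros s1 s2 Hs; simpl; f_equal; apply HA, agree_rup, Hs.
Qed.

Lemma prv_inst3_all n : forall A,
  (forall r r', agree n r r' -> fsubst TVar rid r A = fsubst TVar rid r' A) ->
  prv T [] A -> forall r, prv T [] (fsubst TVar rid r A).
Proof.
  induction n as [|n IH]; intros A HA H r.
  - rewrite (HA r rid), fsubst_id; [assumption | intros i Hi; lia].
  - apply (P_all3I T []) in H.
    apply IH with (r := fun n => r (S n)) in H.
    + apply P_all3E with (Z := r 0) in H.
      replace (fsubst TVar rid r A) with
        (inst3 (r 0) (fsubst TVar rid (rup (fun n => r (S n))) A)); [exact H|].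
      fsubst_tac.
    + intros s1 s2 Hs; simpl; f_equal; apply HA, agree_rup, Hs.
Qed.

(** The set of axioms need not be closed under substitution; generalization in the empty context
    makes up for it. Terms replace number variables last, so that the string variables inside [s1 n]
    are not renamed by [r2]. *)
Lemma provable_subst A s1 r2 r3 : prv T [] A -> prv T [] (fsubst s1 r2 r3 A).
Proof.
  intros H.
  replace (fsubst s1 r2 r3 A) with
    (fsubst s1 rid rid (fsubst TVar r2 rid (fsubst TVar rid r3 A)))
    by (rewrite !fsubst_comp; reflexivity).
  apply prv_inst1_all with (n := fbound (fsubst TVar r2 rid (fsubst TVar rid r3 A))).
  { intros; apply fsubst_agree; (assumption || intros i Hi; reflexivity). }
  apply prv_inst2_all with (n := fbound (fsubst TVar rid r3 A)).
  { intros; apply fsubst_agree; (assumption || intros i Hi; reflexivity). }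
  apply prv_inst3_all with (n := fbound A).
  { intros; apply fsubst_agree; (assumption || intros i Hi; reflexivity). }
  assumption.
Qed.

(** The Henkin construction uses this to turn a fresh variable into the eigenvariable of an
    existential elimination. *)
Lemma prv_subst G A : prv T G A ->
  forall s1 r2 r3, prv T (map (fsubst s1 r2 r3) G) (fsubst s1 r2 r3 A).
Proof.
  induction 1; intros s1 r2 r3.
  - apply prv_weaken with (G := []); [| intros ? []].
    apply provable_subst, P_ax; assumption.
  - apply P_hyp, in_map; assumption.
  - apply P_raa, (IHprv s1 r2 r3).
  - apply P_impI, (IHprv s1 r2 r3).
  - eapply P_impE; [apply (IHprv1 s1 r2 r3) | apply (IHprv2 s1 r2 r3)].
  - apply P_andI; [apply (IHprv1 s1 r2 r3) | apply (IHprv2 s1 r2 r3)].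
  - eapply P_andE1, (IHprv s1 r2 r3).
  - eapply P_andE2, (IHprv s1 r2 r3).
  - apply P_orI1, (IHprv s1 r2 r3).
  - apply P_orI2, (IHprv s1 r2 r3).
  - eapply P_orE; [apply (IHprv1 s1 r2 r3) | apply (IHprv2 s1 r2 r3) | apply (IHprv3 s1 r2 r3)].
  - simpl; apply P_all1I.
    specialize (IHprv (sup1 s1) r2 r3); rewrite map_map in *.
    erewrite map_ext; [exact IHprv|]; intros B; fsubst_tac.
  - replace (fsubst s1 r2 r3 (inst1 t A))
      with (inst1 (tsubst s1 r2 t) (fsubst (sup1 s1) r2 r3 A)) by fsubst_tac.
    apply P_all1E, (IHprv s1 r2 r3).
  - simpl; apply P_ex1I with (t := tsubst s1 r2 t).
    replace (inst1 (tsubst s1 r2 t) (fsubst (sup1 s1) r2 r3 A))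
      with (fsubst s1 r2 r3 (inst1 t A)) by fsubst_tac.
    apply IHprv.
  - eapply P_ex1E; [apply (IHprv1 s1 r2 r3)|].
    specialize (IHprv2 (sup1 s1) r2 r3); simpl in IHprv2.
    replace (lift1 (fsubst s1 r2 r3 B)) with (fsubst (sup1 s1) r2 r3 (lift1 B)) by fsubst_tac.
    rewrite map_map in *.
    erewrite map_ext; [exact IHprv2|]; intros C; fsubst_tac.
  - simpl; apply P_all2I.
    specialize (IHprv (fun n => tlift2 (s1 n)) (rup r2) r3); rewrite map_map in *.
    erewrite map_ext; [exact IHprv|]; intros B; fsubst_tac.
  - replace (fsubst s1 r2 r3 (inst2 X A))
      with (inst2 (r2 X) (fsubst (fun n => tlift2 (s1 n)) (rup r2) r3 A)) by fsubst_tac.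
    apply P_all2E, (IHprv s1 r2 r3).
  - simpl; apply P_ex2I with (X := r2 X).
    replace (inst2 (r2 X) (fsubst (fun n => tlift2 (s1 n)) (rup r2) r3 A))
      with (fsubst s1 r2 r3 (inst2 X A)) by fsubst_tac.
    apply IHprv.
  - eapply P_ex2E; [apply (IHprv1 s1 r2 r3)|].
    specialize (IHprv2 (fun n => tlift2 (s1 n)) (rup r2) r3); simpl in IHprv2.
    replace (lift2 (fsubst s1 r2 r3 B))
      with (fsubst (fun n => tlift2 (s1 n)) (rup r2) r3 (lift2 B)) by fsubst_tac.
    rewrite map_map in *.
    erewrite map_ext; [exact IHprv2|]; intros C; fsubst_tac.
  - simpl; apply P_all3I.
    specialize (IHprv s1 r2 (rup r3)); rewrite map_map in *.
    erewrite map_ext; [exact IHprv|]; intros B; fsubst_tac.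
  - replace (fsubst s1 r2 r3 (inst3 Z A))
      with (inst3 (r3 Z) (fsubst s1 r2 (rup r3) A)) by fsubst_tac.
    apply P_all3E, (IHprv s1 r2 r3).
  - simpl; apply P_ex3I with (Z := r3 Z).
    replace (inst3 (r3 Z) (fsubst s1 r2 (rup r3) A))
      with (fsubst s1 r2 r3 (inst3 Z A)) by fsubst_tac.
    apply IHprv.
  - eapply P_ex3E; [apply (IHprv1 s1 r2 r3)|].
    specialize (IHprv2 s1 r2 (rup r3)); simpl in IHprv2.
    replace (lift3 (fsubst s1 r2 r3 B))
      with (fsubst s1 r2 (rup r3) (lift3 B)) by fsubst_tac.
    rewrite map_map in *.
    erewrite map_ext; [exact IHprv2|]; intros C; fsubst_tac.
  - apply P_eq1_refl.
  - specialize (IHprv1 s1 r2 r3); specialize (IHprv2 s1 r2 r3); simpl in IHprv1.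
    replace (fsubst s1 r2 r3 (inst1 u A))
      with (inst1 (tsubst s1 r2 u) (fsubst (sup1 s1) r2 r3 A)) by fsubst_tac.
    eapply P_eq1_subst; [exact IHprv1|].
    replace (inst1 (tsubst s1 r2 t) (fsubst (sup1 s1) r2 r3 A))
      with (fsubst s1 r2 r3 (inst1 t A)) by fsubst_tac.
    exact IHprv2.
  - apply P_eq2_refl.
  - specialize (IHprv1 s1 r2 r3); specialize (IHprv2 s1 r2 r3); simpl in IHprv1.
    replace (fsubst s1 r2 r3 (inst2 Y A))
      with (inst2 (r2 Y) (fsubst (fun n => tlift2 (s1 n)) (rup r2) r3 A)) by fsubst_tac.
    eapply P_eq2_subst; [exact IHprv1|].
    replace (inst2 (r2 X) (fsubst (fun n => tlift2 (s1 n)) (rup r2) r3 A))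
      with (fsubst s1 r2 r3 (inst2 X A)) by fsubst_tac.
    exact IHprv2.
Qed.

End Derivations.
(** * Structures *)

Record structure : Type := Structure {
  num : Type;
  str : Type;
  hyp : Type;
  zero : num;
  one : num;
  add : num -> num -> num;
  mul : num -> num -> num;
  le : num -> num -> Prop;
  len : str -> num;
  bit : str -> num -> Prop;
  mem : hyp -> str -> Prop
}.

Arguments zero {_}.
Arguments one {_}.
Arguments add {_}.
Arguments mul {_}.
Arguments le {_}.
Arguments len {_}.
Arguments bit {_}.
Arguments mem {_}.

Fixpoint eval {M : structure} (e1 : nat -> num M) (e2 : nat -> str M) (t : tm) : num M :=
  match t with
  | TVar n => e1 n
  | TZero => zero
  | TOne => one
  | TAdd t u => add (eval e1 e2 t) (eval e1 e2 u)
  | TMul t u => mul (eval e1 e2 t) (eval e1 e2 u)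
  | TLen X => len (e2 X)
  end.

Fixpoint sat {M : structure} (e1 : nat -> num M) (e2 : nat -> str M) (e3 : nat -> hyp M)
    (A : fm) : Prop :=
  match A with
  | FBot => False
  | FEq1 t u => eval e1 e2 t = eval e1 e2 u
  | FEq2 X Y => e2 X = e2 Y
  | FLe t u => le (eval e1 e2 t) (eval e1 e2 u)
  | FIn2 X t => bit (e2 X) (eval e1 e2 t)
  | FIn3 Z Y => mem (e3 Z) (e2 Y)
  | FImp A B => sat e1 e2 e3 A -> sat e1 e2 e3 B
  | FAnd A B => sat e1 e2 e3 A /\ sat e1 e2 e3 B
  | FOr A B => sat e1 e2 e3 A \/ sat e1 e2 e3 B
  | FAll1 A => forall d, sat (scons d e1) e2 e3 A
  | FEx1 A => exists d, sat (scons d e1) e2 e3 A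
  | FAll2 A => forall d, sat e1 (scons d e2) e3 A
  | FEx2 A => exists d, sat e1 (scons d e2) e3 A
  | FAll3 A => forall d, sat e1 e2 (scons d e3) A
  | FEx3 A => exists d, sat e1 e2 (scons d e3) A
  end.

Definition models (M : structure) (T : fm -> Prop) : Prop :=
  forall A, T A -> forall (e1 : nat -> num M) e2 e3, sat e1 e2 e3 A.

Lemma scons_map {A B : Type} (f : A -> B) a s :
  (fun n => f (scons a s n)) = scons (f a) (fun n => f (s n)).
Proof. extensionality n; destruct n; reflexivity. Qed.

Lemma scons_rup {A : Type} (a : A) e r :
  (fun n => scons a e (rup r n)) = scons a (fun n => e (r n)).
Proof. extensionality n; destruct n; reflexivity. Qed.

Lemma eval_subst (M : structure) (e1 : nat -> num M) e2 s1 r2 t :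
  eval e1 e2 (tsubst s1 r2 t) = eval (fun n => eval e1 e2 (s1 n)) (fun n => e2 (r2 n)) t.
Proof. induction t; simpl; congruence. Qed.

Lemma eval_sup1 (M : structure) (e1 : nat -> num M) e2 s1 d :
  (fun n => eval (scons d e1) e2 (sup1 s1 n)) = scons d (fun n => eval e1 e2 (s1 n)).
Proof.
  extensionality n; destruct n as [|n]; simpl; [reflexivity|].
  unfold tlift1; rewrite eval_subst; reflexivity.
Qed.

Lemma all_eq {A : Type} (P Q : A -> Prop) :
  (forall d, P d = Q d) -> (forall d, P d) = (forall d, Q d).
Proof. intros H; replace Q with P; [reflexivity | extensionality d; apply H]. Qed.

Lemma ex_eq {A : Type} (P Q : A -> Prop) :
  (forall d, P d = Q d) -> (exists d, P d) = (exists d, Q d).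
Proof. intros H; replace Q with P; [reflexivity | extensionality d; apply H]. Qed.

Lemma eval_tlift2_env (M : structure) (e1 : nat -> num M) e2 (s1 : nat -> tm) d :
  (fun n => eval e1 (scons d e2) (tlift2 (s1 n))) = (fun n => eval e1 e2 (s1 n)).
Proof. extensionality n; unfold tlift2; rewrite eval_subst; reflexivity. Qed.

Lemma sat_subst (M : structure) A : forall (e1 : nat -> num M) e2 e3 s1 r2 r3,
  sat e1 e2 e3 (fsubst s1 r2 r3 A)
  = sat (fun n => eval e1 e2 (s1 n)) (fun n => e2 (r2 n)) (fun n => e3 (r3 n)) A.
Proof.
  induction A; intros; cbn [fsubst sat]; rewrite ?eval_subst;
    first [ reflexivity
          | rewrite IHA1, IHA2; reflexivity
          | first [ apply all_eq | apply ex_eq ]; intros d;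
            rewrite IHA, ?eval_sup1, ?eval_tlift2_env, ?scons_rup; reflexivity ].
Qed.

(** * Henkin completeness *)

Definition code_triple (tag a b : nat) : nat := to_nat (tag, to_nat (a, b)).

Fixpoint tcode (t : tm) : nat :=
  match t with
  | TVar n => code_triple 0 n 0
  | TZero => code_triple 1 0 0
  | TOne => code_triple 2 0 0
  | TAdd t u => code_triple 3 (tcode t) (tcode u)
  | TMul t u => code_triple 4 (tcode t) (tcode u)
  | TLen X => code_triple 5 X 0
  end.

Fixpoint fcode (A : fm) : nat :=
  match A with
  | FBot => code_triple 0 0 0
  | FEq1 t u => code_triple 1 (tcode t) (tcode u)
  | FEq2 X Y => code_triple 2 X Y
  | FLe t u => code_triple 3 (tcode t) (tcode u)
  | FIn2 X t => code_triple 4 X (tcode t)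
  | FIn3 Z Y => code_triple 5 Z Y
  | FImp A B => code_triple 6 (fcode A) (fcode B)
  | FAnd A B => code_triple 7 (fcode A) (fcode B)
  | FOr A B => code_triple 8 (fcode A) (fcode B)
  | FAll1 A => code_triple 9 (fcode A) 0
  | FEx1 A => code_triple 10 (fcode A) 0
  | FAll2 A => code_triple 11 (fcode A) 0
  | FEx2 A => code_triple 12 (fcode A) 0
  | FAll3 A => code_triple 13 (fcode A) 0
  | FEx3 A => code_triple 14 (fcode A) 0
  end.

Lemma code_triple_inj x a b y c d :
  code_triple x a b = code_triple y c d -> x = y /\ a = c /\ b = d.
Proof.
  unfold code_triple; intros H.
  apply to_nat_inj, pair_equal_spec in H; destruct H as [-> H].
  apply to_nat_inj, pair_equal_spec in H; auto.
Qed.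

Ltac code_inj :=
  let u := fresh "u" in let H := fresh "H" in
  intros u; destruct u; cbn [tcode fcode]; intros H; apply code_triple_inj in H;
  destruct H as (H & ? & ?); try discriminate H; f_equal; auto.

Lemma tcode_inj t : forall u, tcode t = tcode u -> t = u.
Proof. induction t; code_inj. Qed.

Lemma fcode_inj A : forall B, fcode A = fcode B -> A = B.
Proof. induction A; code_inj; apply tcode_inj; assumption. Qed.

(** A left inverse of [fcode] suffices: at a number that codes nothing the value is arbitrary, and
    the chain merely considers some formula once more. *)
Definition fenum (n : nat) : fm := epsilon (inhabits FBot) (fun A => fcode A = n).

Lemma fenum_fcode A : fenum (fcode A) = A.
Proof.
  apply fcode_inj; unfold fenum.
  apply (epsilon_spec (inhabits FBot) (fun B => fcode B = fcode A)); exists A; reflexivity.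
Qed.

Section Henkin.

Variable T : fm -> Prop.

Definition consistent (G : list fm) : Prop := ~ prv T G FBot.

Definition fresh (G : list fm) : nat := list_max (map fbound G).

Lemma fresh_bound G A : In A G -> fbound A <= fresh G.
Proof.
  intros H; assert (HF : Forall (fun k => k <= fresh G) (map fbound G))
    by (apply list_max_le; reflexivity).
  rewrite Forall_forall in HF; apply HF, in_map, H.
Qed.

(** Variables serve as Henkin constants. Contexts are finite lists, so a variable beyond all of
    theirs is always left and the language need not be extended. *)
Definition witness (G : list fm) (A : fm) : list fm :=
  let k := fresh G in
  match A with
  | FEx1 C => [inst1 (TVar k) C]
  | FEx2 C => [inst2 k C]
  | FEx3 C => [inst3 k C]
  | _ => []
  end.

Definition redirect {A : Type} (k : nat) (a : A) (s : nat -> A) (i : nat) : A :=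
  if Nat.eqb i k then a else s i.

Lemma redirect_eq {A : Type} k (a : A) s : redirect k a s k = a.
Proof. unfold redirect; rewrite Nat.eqb_refl; reflexivity. Qed.

Lemma redirect_agree {A : Type} n k (a : A) s : n <= k -> agree n (redirect k a s) s.
Proof.
  intros Hk i Hi; unfold redirect; destruct (Nat.eqb_spec i k); [lia | reflexivity].
Qed.

Lemma map_fresh (f g : fm -> fm) G :
  (forall A, fbound A <= fresh G -> f A = g A) -> map f G = map g G.
Proof. intros H; apply map_ext_in; intros A HA; apply H, fresh_bound, HA. Qed.

Lemma witness_consistent G A :
  consistent (A :: G) -> consistent (witness (A :: G) A ++ A :: G).
Proof.
  intros HG HF; apply HG.
  assert (HA : fbound A <= fresh (A :: G)) by (apply fresh_bound; left; reflexivity).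
  destruct A; simpl app in HF; try exact HF;
    match goal with |- prv _ (?F :: _) _ => set (G' := F :: G) in * end;
    unfold witness in HF; simpl app in HF; set (k := fresh G') in *;
    simpl fbound in HA.
  - apply P_ex1E with (A := A); [apply P_hyp; left; reflexivity|].
    (* Shifting all variables but sending the fresh [k] to 0 lifts the context and turns the witness
       back into the body [A], as the elimination rule requires. *)
    apply prv_subst with (s1 := redirect k (TVar 0) shift1) (r2 := rid) (r3 := rid) in HF.
    cbn [map] in HF.
    rewrite (map_fresh (fsubst (redirect k (TVar 0) shift1) rid rid) lift1) in HF.
    2:{ intros B HB; apply fsubst_agree; [apply redirect_agree; assumption | | ];
        intros i Hi; reflexivity. }
    replace (fsubst (redirect k (TVar 0) shift1) rid rid (inst1 (TVar k) A)) with A in HF;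
      [exact HF|].
    unfold inst1; rewrite fsubst_comp, <- fsubst_id at 1.
    apply fsubst_agree; intros [|i] Hi; simpl; try reflexivity.
    + symmetry; apply redirect_eq.
    + rewrite (redirect_agree k); [reflexivity | lia | lia].
  - apply P_ex2E with (A := A); [apply P_hyp; left; reflexivity|].
    apply prv_subst with (s1 := TVar) (r2 := redirect k 0 S) (r3 := rid) in HF.
    cbn [map] in HF.
    rewrite (map_fresh (fsubst TVar (redirect k 0 S) rid) lift2) in HF.
    2:{ intros B HB; apply fsubst_agree; [ | apply redirect_agree; assumption | ];
        intros i Hi; reflexivity. }
    replace (fsubst TVar (redirect k 0 S) rid (inst2 k A)) with A in HF;
      [exact HF|].
    unfold inst2; rewrite fsubst_comp, <- fsubst_id at 1.
    apply fsubst_agree; intros [|i] Hi; simpl; try reflexivity.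
    + symmetry; apply redirect_eq.
    + unfold rid; rewrite (redirect_agree k); [reflexivity | lia | lia].
  - apply P_ex3E with (A := A); [apply P_hyp; left; reflexivity|].
    apply prv_subst with (s1 := TVar) (r2 := rid) (r3 := redirect k 0 S) in HF.
    cbn [map] in HF.
    rewrite (map_fresh (fsubst TVar rid (redirect k 0 S)) lift3) in HF.
    2:{ intros B HB; apply fsubst_agree; [ | | apply redirect_agree; assumption ];
        intros i Hi; reflexivity. }
    replace (fsubst TVar rid (redirect k 0 S) (inst3 k A)) with A in HF;
      [exact HF|].
    unfold inst3; rewrite fsubst_comp, <- fsubst_id at 1.
    apply fsubst_agree; intros [|i] Hi; simpl; try reflexivity.
    + symmetry; apply redirect_eq.
    + unfold rid; rewrite (redirect_agree k); [reflexivity | lia | lia].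
Qed.

Variable A0 : fm.
Hypothesis HA0 : ~ prv T [] A0.

Fixpoint chain (n : nat) : list fm :=
  match n with
  | 0 => [FNot A0]
  | S n =>
      let G := fenum n :: chain n in
      if excluded_middle_informative (consistent G)
      then witness G (fenum n) ++ G else chain n
  end.

Lemma chain_consistent n : consistent (chain n).
Proof.
  induction n as [|n IH]; simpl.
  - intros H; apply HA0, P_raa, H.
  - destruct excluded_middle_informative as [H|_]; [|exact IH].
    apply witness_consistent, H.
Qed.

Lemma chain_mono m n : m <= n -> incl (chain m) (chain n).
Proof.
  induction 1 as [|n H IH]; [apply incl_refl|].
  apply incl_tran with (1 := IH); simpl.
  destruct excluded_middle_informative; [|apply incl_refl].
  apply incl_appr, incl_tl, incl_refl.
Qed.

(** The maximal consistent Henkin theory extending the negation of [A0]. *)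
Definition Th (A : fm) : Prop := exists n, prv T (chain n) A.

Lemma Th_prv A : prv T [] A -> Th A.
Proof. intros H; exists 0; eapply prv_weaken; [exact H | intros ? []]. Qed.

Lemma Th_bot : ~ Th FBot.
Proof. intros [n H]; exact (chain_consistent n H). Qed.

Lemma Th_A0 : Th (FNot A0).
Proof. exists 0; apply P_hyp; left; reflexivity. Qed.

Lemma Th_ded1 A B : Th A -> (forall G, prv T G A -> prv T G B) -> Th B.
Proof. intros [n H] HB; exists n; auto. Qed.

Lemma Th_ded2 A B C :
  Th A -> Th B -> (forall G, prv T G A -> prv T G B -> prv T G C) -> Th C.
Proof.
  intros [m HA] [n HB] HC; exists (max m n); apply HC.
  - eapply prv_weaken; [exact HA | apply chain_mono; lia].
  - eapply prv_weaken; [exact HB | apply chain_mono; lia].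
Qed.

Lemma Th_mp A B : Th (FImp A B) -> Th A -> Th B.
Proof. intros H1 H2; apply (Th_ded2 _ _ _ H1 H2); intros; eapply P_impE; eauto. Qed.

(** Stage [fcode A] settles [A]. The first alternative records what the chain contains, not just
    what it derives, because the witness of an existential formula is stored at the same stage. *)
Lemma Th_dec A :
  In A (chain (S (fcode A))) /\ incl (witness (A :: chain (fcode A)) A) (chain (S (fcode A)))
  \/ Th (FNot A).
Proof.
  simpl; rewrite fenum_fcode.
  destruct excluded_middle_informative as [H|H].
  - left; split; [apply in_or_app; right; left; reflexivity | apply incl_appl, incl_refl].
  - right; exists (fcode A); apply NNPP in H; apply P_impI, H.
Qed.

Lemma Th_not A : Th (FNot A) <-> ~ Th A.
Proof.
  split.
  - intros H HA; apply Th_bot, (Th_mp A); assumption.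
  - intros H; destruct (Th_dec A) as [[HA _]|HA]; [|exact HA].
    exfalso; apply H; eexists; apply P_hyp, HA.
Qed.

Lemma Th_imp A B : Th (FImp A B) <-> (Th A -> Th B).
Proof.
  split; [apply Th_mp|].
  intros H; destruct (classic (Th A)) as [HA|HA].
  - apply (Th_ded1 B); [auto|]; intros G HB; apply P_impI.
    eapply prv_weaken; [exact HB | apply incl_tl, incl_refl].
  - apply Th_not in HA; apply (Th_ded1 _ _ HA); intros G HN; apply P_impI, P_raa.
    eapply P_impE; [eapply prv_weaken; [exact HN |] |].
    + apply incl_tl, incl_tl, incl_refl.
    + apply P_hyp; right; left; reflexivity.
Qed.

Lemma Th_and A B : Th (FAnd A B) <-> Th A /\ Th B.
Proof.
  split.
  - intros H; split; apply (Th_ded1 _ _ H); intros G; [apply P_andE1 | apply P_andE2].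
  - intros [HA HB]; apply (Th_ded2 _ _ _ HA HB); intros G; apply P_andI.
Qed.

Lemma Th_or A B : Th (FOr A B) <-> Th A \/ Th B.
Proof.
  split.
  - intros H; destruct (classic (Th A)) as [HA|HA]; [left; exact HA | right].
    apply Th_not in HA; apply (Th_ded2 _ _ _ H HA); intros G HO HN.
    eapply P_orE; [exact HO | | apply P_hyp; left; reflexivity].
    apply P_raa; eapply P_impE; [eapply prv_weaken; [exact HN|] |].
    + apply incl_tl, incl_tl, incl_refl.
    + apply P_hyp; right; left; reflexivity.
  - intros [H|H]; apply (Th_ded1 _ _ H); intros G; [apply P_orI1 | apply P_orI2].
Qed.

Lemma Th_ex1 A : Th (FEx1 A) <-> exists t, Th (inst1 t A).
Proof.
  split.
  - intros H; destruct (Th_dec (FEx1 A)) as [[_ HW]|HN].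
    + eexists; eexists; apply P_hyp, HW; left; reflexivity.
    + apply Th_not in HN; contradiction.
  - intros [t H]; apply (Th_ded1 _ _ H); intros G; apply P_ex1I.
Qed.

Lemma Th_ex2 A : Th (FEx2 A) <-> exists X, Th (inst2 X A).
Proof.
  split.
  - intros H; destruct (Th_dec (FEx2 A)) as [[_ HW]|HN].
    + eexists; eexists; apply P_hyp, HW; left; reflexivity.
    + apply Th_not in HN; contradiction.
  - intros [t H]; apply (Th_ded1 _ _ H); intros G; apply P_ex2I.
Qed.

Lemma Th_ex3 A : Th (FEx3 A) <-> exists Z, Th (inst3 Z A).
Proof.
  split.
  - intros H; destruct (Th_dec (FEx3 A)) as [[_ HW]|HN].
    + eexists; eexists; apply P_hyp, HW; left; reflexivity.
    + apply Th_not in HN; contradiction.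
  - intros [t H]; apply (Th_ded1 _ _ H); intros G; apply P_ex3I.
Qed.

Ltac not_forall_tac I E :=
  intros G H; apply P_raa; eapply P_impE;
  [ eapply prv_weaken; [exact H | apply incl_tl, incl_refl] |];
  apply I; apply P_raa; eapply P_impE;
  [ apply P_hyp; right; left; reflexivity |];
  simpl; eapply E; unfold inst1, inst2, inst3; simpl;
  apply P_hyp; left; unfold FNot; f_equal.

(** Witnesses are stored for existential formulas only; this duality makes them available for
    refuted universal ones. *)
Lemma prv_not_all1 A G : prv T G (FNot (FAll1 A)) -> prv T G (FEx1 (FNot A)).
Proof.
  revert G; not_forall_tac P_all1I (fun T G A => P_ex1I T G A (TVar 0)).
  fsubst_tac.
Qed.

Lemma prv_not_all2 A G : prv T G (FNot (FAll2 A)) -> prv T G (FEx2 (FNot A)).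
Proof.
  revert G; not_forall_tac P_all2I (fun T G A => P_ex2I T G A 0).
  fsubst_tac.
Qed.

Lemma prv_not_all3 A G : prv T G (FNot (FAll3 A)) -> prv T G (FEx3 (FNot A)).
Proof.
  revert G; not_forall_tac P_all3I (fun T G A => P_ex3I T G A 0).
  fsubst_tac.
Qed.

Lemma Th_all1 A : Th (FAll1 A) <-> forall t, Th (inst1 t A).
Proof.
  split.
  - intros H t; apply (Th_ded1 _ _ H); intros G; apply P_all1E.
  - intros H; apply NNPP; intros HN; apply Th_not in HN.
    assert (HE : Th (FEx1 (FNot A))) by (apply (Th_ded1 _ _ HN), prv_not_all1).
    apply Th_ex1 in HE; destruct HE as [t Ht].
    apply (proj1 (Th_not (inst1 t A)) Ht), H.
Qed.

Lemma Th_all2 A : Th (FAll2 A) <-> forall X, Th (inst2 X A).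
Proof.
  split.
  - intros H t; apply (Th_ded1 _ _ H); intros G; apply P_all2E.
  - intros H; apply NNPP; intros HN; apply Th_not in HN.
    assert (HE : Th (FEx2 (FNot A))) by (apply (Th_ded1 _ _ HN), prv_not_all2).
    apply Th_ex2 in HE; destruct HE as [t Ht].
    apply (proj1 (Th_not (inst2 t A)) Ht), H.
Qed.

Lemma Th_all3 A : Th (FAll3 A) <-> forall Z, Th (inst3 Z A).
Proof.
  split.
  - intros H t; apply (Th_ded1 _ _ H); intros G; apply P_all3E.
  - intros H; apply NNPP; intros HN; apply Th_not in HN.
    assert (HE : Th (FEx3 (FNot A))) by (apply (Th_ded1 _ _ HN), prv_not_all3).
    apply Th_ex3 in HE; destruct HE as [t Ht].
    apply (proj1 (Th_not (inst3 t A)) Ht), H.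
Qed.

(** * Equality in the Henkin theory and the term model *)

Lemma Th_eq1_subst A t u : Th (FEq1 t u) -> Th (inst1 t A) -> Th (inst1 u A).
Proof. intros H HA; apply (Th_ded2 _ _ _ H HA); intros G; apply P_eq1_subst. Qed.

Lemma Th_eq2_subst A X Y : Th (FEq2 X Y) -> Th (inst2 X A) -> Th (inst2 Y A).
Proof. intros H HA; apply (Th_ded2 _ _ _ H HA); intros G; apply P_eq2_subst. Qed.

Lemma inst1_tlift1 u t : tsubst (scons u TVar) rid (tlift1 t) = t.
Proof. unfold tlift1; rewrite tsubst_comp; apply tsubst_id. Qed.

Lemma inst2_tlift2 X t : tsubst TVar (scons X rid) (tlift2 t) = t.
Proof. unfold tlift2; rewrite tsubst_comp; apply tsubst_id. Qed.

(** [A] is a pattern whose variable 0 marks the place of exchange; the other terms in it have to be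
    lifted past that hole. *)
Ltac Th_rewrite H A HT :=
  first [ pose proof (Th_eq1_subst A _ _ H) as HT | pose proof (Th_eq2_subst A _ _ H) as HT ];
  unfold inst1, inst2 in HT; cbn [fsubst tsubst scons] in HT;
  rewrite ?inst1_tlift1, ?inst2_tlift2 in HT.

Lemma Th_eq1_refl t : Th (FEq1 t t).
Proof. apply Th_prv, P_eq1_refl. Qed.

Lemma Th_eq2_refl X : Th (FEq2 X X).
Proof. apply Th_prv, P_eq2_refl. Qed.

Lemma Th_eq1_sym t u : Th (FEq1 t u) -> Th (FEq1 u t).
Proof.
  intros H; Th_rewrite H (FEq1 (TVar 0) (tlift1 t)) HT; apply HT, Th_eq1_refl.
Qed.

Lemma Th_eq2_sym X Y : Th (FEq2 X Y) -> Th (FEq2 Y X).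
Proof.
  intros H; Th_rewrite H (FEq2 0 (S X)) HT; apply HT, Th_eq2_refl.
Qed.

Lemma Th_eq1_trans t u v : Th (FEq1 t u) -> Th (FEq1 u v) -> Th (FEq1 t v).
Proof.
  intros H1 H; Th_rewrite H (FEq1 (tlift1 t) (TVar 0)) HT; auto.
Qed.

Lemma Th_eq2_trans X Y Z : Th (FEq2 X Y) -> Th (FEq2 Y Z) -> Th (FEq2 X Z).
Proof. intros H1 H; Th_rewrite H (FEq2 (S X) 0) HT; auto. Qed.

(** Satisfaction reads equality as identity, so provably equal terms must become one element. Choice
    picks a representative of each class: equal classes are equal predicates, on which [epsilon]
    gives equal values. *)
Definition rep1 (t : tm) : tm := epsilon (inhabits TZero) (fun u => Th (FEq1 t u)).
Definition rep2 (X : nat) : nat := epsilon (inhabits 0) (fun Y => Th (FEq2 X Y)).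

Lemma rep1_spec t : Th (FEq1 t (rep1 t)).
Proof. unfold rep1; apply epsilon_spec; exists t; apply Th_eq1_refl. Qed.

Lemma rep2_spec X : Th (FEq2 X (rep2 X)).
Proof. unfold rep2; apply epsilon_spec; exists X; apply Th_eq2_refl. Qed.

Lemma rep1_eq t u : Th (FEq1 t u) -> rep1 t = rep1 u.
Proof.
  intros H; unfold rep1; f_equal; extensionality v; apply propositional_extensionality.
  split; intros; eapply Th_eq1_trans; eauto; apply Th_eq1_sym; assumption.
Qed.

Lemma rep2_eq X Y : Th (FEq2 X Y) -> rep2 X = rep2 Y.
Proof.
  intros H; unfold rep2; f_equal; extensionality v; apply propositional_extensionality.
  split; intros; eapply Th_eq2_trans; eauto; apply Th_eq2_sym; assumption.
Qed.

Definition cl1 (t : tm) : {t | rep1 t = t} :=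
  exist _ (rep1 t) (eq_sym (rep1_eq _ _ (rep1_spec t))).
Definition cl2 (X : nat) : {X | rep2 X = X} :=
  exist _ (rep2 X) (eq_sym (rep2_eq _ _ (rep2_spec X))).

Lemma cl1_eq t u : cl1 t = cl1 u <-> Th (FEq1 t u).
Proof.
  split; intros H.
  - apply (f_equal (@proj1_sig _ _)) in H; simpl in H.
    apply Th_eq1_trans with (rep1 t); [apply rep1_spec|].
    rewrite H; apply Th_eq1_sym, rep1_spec.
  - apply eq_sig_hprop; [intros; apply proof_irrelevance | apply rep1_eq, H].
Qed.

Lemma cl2_eq X Y : cl2 X = cl2 Y <-> Th (FEq2 X Y).
Proof.
  split; intros H.
  - apply (f_equal (@proj1_sig _ _)) in H; simpl in H.
    apply Th_eq2_trans with (rep2 X); [apply rep2_spec|].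
    rewrite H; apply Th_eq2_sym, rep2_spec.
  - apply eq_sig_hprop; [intros; apply proof_irrelevance | apply rep2_eq, H].
Qed.

Lemma cl1_surj d : cl1 (proj1_sig d) = d.
Proof. apply eq_sig_hprop; [intros; apply proof_irrelevance | apply (proj2_sig d)]. Qed.

Lemma cl2_surj d : cl2 (proj1_sig d) = d.
Proof. apply eq_sig_hprop; [intros; apply proof_irrelevance | apply (proj2_sig d)]. Qed.

(** The language has no equality between hyper strings, so their variables form the third sort as
    they are. *)
Definition term_model : structure :=
  Structure {t | rep1 t = t} {X | rep2 X = X} nat
    (cl1 TZero) (cl1 TOne)
    (fun a b => cl1 (TAdd (proj1_sig a) (proj1_sig b)))
    (fun a b => cl1 (TMul (proj1_sig a) (proj1_sig b)))
    (fun a b => Th (FLe (proj1_sig a) (proj1_sig b)))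
    (fun X => cl1 (TLen (proj1_sig X)))
    (fun X a => Th (FIn2 (proj1_sig X) (proj1_sig a)))
    (fun Z X => Th (FIn3 Z (proj1_sig X))).

Lemma eval_term_model s1 r2 t :
  @eval term_model (fun n => cl1 (s1 n)) (fun n => cl2 (r2 n)) t = cl1 (tsubst s1 r2 t).
Proof.
  induction t; simpl; try reflexivity.
  - rewrite IHt1, IHt2; simpl; apply cl1_eq, Th_eq1_sym.
    set (t := tsubst s1 r2 t1); set (u := tsubst s1 r2 t2).
    Th_rewrite (rep1_spec t) (FEq1 (TAdd (tlift1 t) (tlift1 u)) (TAdd (TVar 0) (tlift1 u))) H1.
    Th_rewrite (rep1_spec u)
      (FEq1 (TAdd (tlift1 t) (tlift1 u)) (TAdd (tlift1 (rep1 t)) (TVar 0))) H2.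
    apply H2, H1, Th_eq1_refl.
  - rewrite IHt1, IHt2; simpl; apply cl1_eq, Th_eq1_sym.
    set (t := tsubst s1 r2 t1); set (u := tsubst s1 r2 t2).
    Th_rewrite (rep1_spec t) (FEq1 (TMul (tlift1 t) (tlift1 u)) (TMul (TVar 0) (tlift1 u))) H1.
    Th_rewrite (rep1_spec u)
      (FEq1 (TMul (tlift1 t) (tlift1 u)) (TMul (tlift1 (rep1 t)) (TVar 0))) H2.
    apply H2, H1, Th_eq1_refl.
  - apply cl1_eq, Th_eq1_sym.
    Th_rewrite (rep2_spec (r2 X)) (FEq1 (TLen (S (r2 X))) (TLen 0)) H1.
    apply H1, Th_eq1_refl.
Qed.

Lemma Th_le_rep t u : Th (FLe (rep1 t) (rep1 u)) <-> Th (FLe t u).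
Proof.
  split; intros H.
  - Th_rewrite (Th_eq1_sym _ _ (rep1_spec t)) (FLe (TVar 0) (tlift1 (rep1 u))) H1.
    Th_rewrite (Th_eq1_sym _ _ (rep1_spec u)) (FLe (tlift1 t) (TVar 0)) H2; auto.
  - Th_rewrite (rep1_spec t) (FLe (TVar 0) (tlift1 u)) H1.
    Th_rewrite (rep1_spec u) (FLe (tlift1 (rep1 t)) (TVar 0)) H2; auto.
Qed.

Lemma Th_in2_rep X t : Th (FIn2 (rep2 X) (rep1 t)) <-> Th (FIn2 X t).
Proof.
  split; intros H.
  - Th_rewrite (Th_eq2_sym _ _ (rep2_spec X)) (FIn2 0 (tlift2 (rep1 t))) H1.
    Th_rewrite (Th_eq1_sym _ _ (rep1_spec t)) (FIn2 X (TVar 0)) H2; auto.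
  - Th_rewrite (rep2_spec X) (FIn2 0 (tlift2 t)) H1.
    Th_rewrite (rep1_spec t) (FIn2 (rep2 X) (TVar 0)) H2; auto.
Qed.

Lemma Th_in3_rep Z X : Th (FIn3 Z (rep2 X)) <-> Th (FIn3 Z X).
Proof.
  split; intros H.
  - Th_rewrite (Th_eq2_sym _ _ (rep2_spec X)) (FIn3 Z 0) H1; auto.
  - Th_rewrite (rep2_spec X) (FIn3 Z 0) H1; auto.
Qed.

Lemma inst1_sup1 t s1 r2 r3 A :
  inst1 t (fsubst (sup1 s1) r2 r3 A) = fsubst (scons t s1) r2 r3 A.
Proof. fsubst_tac. Qed.

Lemma inst2_rup X s1 r2 r3 A :
  inst2 X (fsubst (fun n => tlift2 (s1 n)) (rup r2) r3 A) = fsubst s1 (scons X r2) r3 A.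
Proof. fsubst_tac. Qed.

Lemma inst3_rup Z s1 r2 r3 A :
  inst3 Z (fsubst s1 r2 (rup r3) A) = fsubst s1 r2 (scons Z r3) A.
Proof. fsubst_tac. Qed.

(** The truth lemma is stated for assignments given by arbitrary substitutions, so that passing a
    quantifier merely extends the substitution. *)
Lemma sat_term_model A : forall s1 r2 r3,
  @sat term_model (fun n => cl1 (s1 n)) (fun n => cl2 (r2 n)) r3 A
  <-> Th (fsubst s1 r2 r3 A).
Proof.
  induction A; intros s1 r2 r3; cbn [sat fsubst]; rewrite ?eval_term_model.
  - split; [tauto | apply Th_bot].
  - apply cl1_eq.
  - apply cl2_eq.
  - apply Th_le_rep.
  - apply Th_in2_rep.
  - apply Th_in3_rep.
  - rewrite Th_imp, IHA1, IHA2; reflexivity.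
  - rewrite Th_and, IHA1, IHA2; reflexivity.
  - rewrite Th_or, IHA1, IHA2; reflexivity.
  - rewrite Th_all1; split; intros H.
    + intros t; rewrite inst1_sup1; apply IHA; rewrite scons_map; apply H.
    + intros d; rewrite <- (cl1_surj d), <- scons_map; apply IHA; rewrite <- inst1_sup1; apply H.
  - rewrite Th_ex1; split; intros [d H].
    + exists (proj1_sig d); rewrite inst1_sup1; apply IHA; rewrite scons_map, cl1_surj; apply H.
    + exists (cl1 d); rewrite <- scons_map; apply IHA; rewrite <- inst1_sup1; apply H.
  - rewrite Th_all2; split; intros H.
    + intros t; rewrite inst2_rup; apply IHA; rewrite scons_map; apply H.
    + intros d; rewrite <- (cl2_surj d), <- scons_map; apply IHA; rewrite <- inst2_rup; apply H.
  - rewrite Th_ex2; split; intros [d H].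
    + exists (proj1_sig d); rewrite inst2_rup; apply IHA; rewrite scons_map, cl2_surj; apply H.
    + exists (cl2 d); rewrite <- scons_map; apply IHA; rewrite <- inst2_rup; apply H.
  - rewrite Th_all3; split; intros H d.
    + rewrite inst3_rup; apply IHA, H.
    + apply IHA; rewrite <- inst3_rup; apply H.
  - rewrite Th_ex3; split; intros [d H]; exists d.
    + rewrite inst3_rup; apply IHA, H.
    + apply IHA; rewrite <- inst3_rup; apply H.
Qed.

End Henkin.

Theorem completeness (T : fm -> Prop) (A : fm) :
  (forall M : structure, models M T -> forall (e1 : nat -> num M) e2 e3, sat e1 e2 e3 A) ->
  provable T A.
Proof.
  intros H; apply NNPP; intros HA.
  apply (Th_not T A HA A); [apply Th_A0|].
  pose proof (proj1 (sat_term_model T A HA A TVar rid rid)) as HM.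
  rewrite fsubst_id in HM; apply HM, H.
  intros B HB e1 e2 e3.
  (* Every assignment comes from a substitution by representatives, and instances of an axiom under
     substitution are provable. *)
  replace e1 with (fun n => cl1 T A (proj1_sig (e1 n)))
    by (extensionality n; apply cl1_surj).
  replace e2 with (fun n => cl2 T A (proj1_sig (e2 n)))
    by (extensionality n; apply cl2_surj).
  apply (sat_term_model T A HA), Th_prv, provable_subst, P_ax, HB.
Qed.

(** * Bounded definability in a structure *)

Lemma SigmaBB0_fsubst A : SigmaBB0 A ->
  forall s1 r2 r3, SigmaBB0 (fsubst s1 r2 r3 A).
Proof.
  induction 1; intros s1 r2 r3; cbn [fsubst]; try (constructor; auto; fail).
  - replace (fsubst s1 r2 r3 (all_le t A))
      with (all_le (tsubst s1 r2 t) (fsubst (sup1 s1) r2 r3 A)); [constructor; auto|].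
    unfold all_le; cbn [fsubst tsubst sup1 scons]; unfold tlift1; rewrite !tsubst_comp; reflexivity.
  - replace (fsubst s1 r2 r3 (ex_le t A))
      with (ex_le (tsubst s1 r2 t) (fsubst (sup1 s1) r2 r3 A)); [constructor; auto|].
    unfold ex_le; cbn [fsubst tsubst sup1 scons]; unfold tlift1; rewrite !tsubst_comp; reflexivity.
  - replace (fsubst s1 r2 r3 (all2_le t A))
      with (all2_le (tsubst s1 r2 t) (fsubst (fun n => tlift2 (s1 n)) (rup r2) r3 A));
      [constructor; auto|].
    unfold all2_le; cbn [fsubst tsubst rup scons]; unfold tlift2; rewrite !tsubst_comp; reflexivity.
  - replace (fsubst s1 r2 r3 (ex2_le t A))
      with (ex2_le (tsubst s1 r2 t) (fsubst (fun n => tlift2 (s1 n)) (rup r2) r3 A));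
      [constructor; auto|].
    unfold ex2_le; cbn [fsubst tsubst rup scons]; unfold tlift2; rewrite !tsubst_comp; reflexivity.
Qed.

Lemma SigmaB0_SigmaBB0 A : SigmaB0 A -> SigmaBB0 A.
Proof. induction 1; constructor; auto. Qed.

Section InStructure.

Variable M : structure.
(* The sorts of strings and hyper strings need an element to fill unused parameter slots. *)
Variable a1 : num M.
Variable a2 : str M.
Variable a3 : hyp M.

Definition lt (a b : num M) : Prop := le a b /\ a <> b.

Inductive sort : Type := S1 | S2 | S3.

Definition dom (s : sort) : Type :=
  match s with S1 => num M | S2 => str M | S3 => hyp M end.

(** The head of [c] is the innermost variable. Each sort has its own index space, which is why one
    tuple yields three environments. *)
Fixpoint ctx (c : list sort) : Type :=
  match c with [] => unit | s :: c => (ctx c * dom s)%type end.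

Fixpoint env1 (c : list sort) : ctx c -> (nat -> num M) -> nat -> num M :=
  match c with
  | [] => fun _ e => e
  | S1 :: c => fun v e => scons (snd v) (env1 c (fst v) e)
  | _ :: c => fun v e => env1 c (fst v) e
  end.

Fixpoint env2 (c : list sort) : ctx c -> (nat -> str M) -> nat -> str M :=
  match c with
  | [] => fun _ e => e
  | S2 :: c => fun v e => scons (snd v) (env2 c (fst v) e)
  | _ :: c => fun v e => env2 c (fst v) e
  end.

Fixpoint env3 (c : list sort) : ctx c -> (nat -> hyp M) -> nat -> hyp M :=
  match c with
  | [] => fun _ e => e
  | S3 :: c => fun v e => scons (snd v) (env3 c (fst v) e)
  | _ :: c => fun v e => env3 c (fst v) e
  end.

Definition covers {A : Type} (l e : nat -> A) : Prop :=
  exists r : nat -> nat, forall n, e (r n) = l n.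

Record params : Type := Params {
  par1 : nat -> num M;
  par2 : nat -> str M;
  par3 : nat -> hyp M
}.

Definition pcovers (l e : params) : Prop :=
  covers (par1 l) (par1 e) /\ covers (par2 l) (par2 e) /\ covers (par3 l) (par3 e).

(** Even positions hold one parameter list and odd positions the other, so that one assignment
    serves two definitions. *)
Definition interleave {A : Type} (l l' : nat -> A) (n : nat) : A :=
  if Nat.even n then l (Nat.div2 n) else l' (Nat.div2 n).

Definition merge (l l' : params) : params :=
  Params (interleave (par1 l) (par1 l')) (interleave (par2 l) (par2 l'))
    (interleave (par3 l) (par3 l')).

Definition default : params := Params (fun _ => a1) (fun _ => a2) (fun _ => a3).

Lemma covers_interleave {A : Type} (l l' e : nat -> A) :
  covers (interleave l l') e -> covers l e /\ covers l' e.
Proof.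
  intros [r Hr]; split.
  - exists (fun n => r (2 * n)); intros n; rewrite Hr; unfold interleave.
    rewrite Nat.even_mul, Nat.div2_double; reflexivity.
  - exists (fun n => r (S (2 * n))); intros n; rewrite Hr; unfold interleave.
    rewrite Nat.even_succ, Nat.odd_mul, Nat.div2_succ_double; reflexivity.
Qed.

Lemma pcovers_merge l l' e : pcovers (merge l l') e -> pcovers l e /\ pcovers l' e.
Proof.
  intros (H1 & H2 & H3).
  apply covers_interleave in H1, H2, H3; unfold pcovers; tauto.
Qed.

Lemma pcovers_refl e : pcovers e e.
Proof. repeat split; exists (fun n => n); reflexivity. Qed.

Definition evalc {c} (v : ctx c) (e : params) (t : tm) : num M :=
  eval (env1 c v (par1 e)) (env2 c v (par2 e)) t.

Definition satc {c} (v : ctx c) (e : params) (A : fm) : Prop :=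
  sat (env1 c v (par1 e)) (env2 c v (par2 e)) (env3 c v (par3 e)) A.

(** Definability of a relation, or of a value, by a bounded formula, a term or a
    variable, with parameters in the structure.  The formula may depend on where the
    assignment lists the parameters: two definitions can then be combined over a
    common assignment without renaming variables. *)
Definition definable (D : params -> Prop) : Prop :=
  exists l, forall e, pcovers l e -> D e.

Definition Def (c : list sort) (P : ctx c -> Prop) : Prop :=
  definable (fun e => exists A, SigmaBB0 A /\ forall v, satc v e A <-> P v).

Definition DefN (c : list sort) (f : ctx c -> num M) : Prop :=
  definable (fun e => exists t, forall v, evalc v e t = f v).

Definition DefS (c : list sort) (f : ctx c -> str M) : Prop :=
  definable (fun e => exists n, forall v, env2 c v (par2 e) n = f v).

Definition DefH (c : list sort) (f : ctx c -> hyp M) : Prop :=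
  definable (fun e => exists n, forall v, env3 c v (par3 e) n = f v).

Lemma definable_0 (D : params -> Prop) : (forall e, D e) -> definable D.
Proof. exists default; auto. Qed.

Lemma definable_1 (D D' : params -> Prop) :
  (forall e, D e -> D' e) -> definable D -> definable D'.
Proof. intros H [l Hl]; exists l; auto. Qed.

Lemma definable_2 (D D' D'' : params -> Prop) :
  (forall e, D e -> D' e -> D'' e) -> definable D -> definable D' -> definable D''.
Proof.
  intros H [l Hl] [l' Hl']; exists (merge l l'); intros e He.
  apply pcovers_merge in He; apply H; [apply Hl | apply Hl']; apply He.
Qed.

Lemma def_ext c (P Q : ctx c -> Prop) : (forall v, P v <-> Q v) -> Def c P -> Def c Q.
Proof.
  intros H; apply definable_1; intros e (A & HA & HP); exists A; split; [exact HA|].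
  intros v; rewrite HP; apply H.
Qed.

Lemma def_const c (P : Prop) : Def c (fun _ => P).
Proof.
  apply definable_0; intros e; destruct (classic P).
  - exists (FImp FBot FBot); split; [repeat constructor | unfold satc; simpl; tauto].
  - exists FBot; split; [constructor | unfold satc; simpl; tauto].
Qed.

Lemma def_imp c (P Q : ctx c -> Prop) :
  Def c P -> Def c Q -> Def c (fun v => P v -> Q v).
Proof.
  apply definable_2; intros e (A & HA & HP) (B & HB & HQ); exists (FImp A B).
  split; [constructor; assumption | intros v; rewrite <- HP, <- HQ; reflexivity].
Qed.

Lemma def_and c (P Q : ctx c -> Prop) :
  Def c P -> Def c Q -> Def c (fun v => P v /\ Q v).
Proof.
  apply definable_2; intros e (A & HA & HP) (B & HB & HQ); exists (FAnd A B).
  split; [constructor; assumption | intros v; rewrite <- HP, <- HQ; reflexivity].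
Qed.

Lemma def_or c (P Q : ctx c -> Prop) :
  Def c P -> Def c Q -> Def c (fun v => P v \/ Q v).
Proof.
  apply definable_2; intros e (A & HA & HP) (B & HB & HQ); exists (FOr A B).
  split; [constructor; assumption | intros v; rewrite <- HP, <- HQ; reflexivity].
Qed.

Lemma def_eq1 c f g : DefN c f -> DefN c g -> Def c (fun v => f v = g v).
Proof.
  apply definable_2; intros e [t Ht] [u Hu]; exists (FEq1 t u).
  split; [constructor | intros v; rewrite <- Ht, <- Hu; reflexivity].
Qed.

Lemma def_le c f g : DefN c f -> DefN c g -> Def c (fun v => le (f v) (g v)).
Proof.
  apply definable_2; intros e [t Ht] [u Hu]; exists (FLe t u).
  split; [constructor | intros v; rewrite <- Ht, <- Hu; reflexivity].
Qed.

Lemma def_eq2 c f g : DefS c f -> DefS c g -> Def c (fun v => f v = g v).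
Proof.
  apply definable_2; intros e [t Ht] [u Hu]; exists (FEq2 t u).
  split; [constructor | intros v; rewrite <- Ht, <- Hu; reflexivity].
Qed.

Lemma def_bit c f g : DefS c f -> DefN c g -> Def c (fun v => bit (f v) (g v)).
Proof.
  apply definable_2; intros e [t Ht] [u Hu]; exists (FIn2 t u).
  split; [constructor | intros v; rewrite <- Ht, <- Hu; reflexivity].
Qed.

Lemma def_mem c f g : DefH c f -> DefS c g -> Def c (fun v => mem (f v) (g v)).
Proof.
  apply definable_2; intros e [t Ht] [u Hu]; exists (FIn3 t u).
  split; [constructor | intros v; rewrite <- Ht, <- Hu; reflexivity].
Qed.

Lemma eval_tlift1 (e1 : nat -> num M) e2 d t :
  eval (scons d e1) e2 (tlift1 t) = eval e1 e2 t.
Proof. unfold tlift1; rewrite eval_subst; reflexivity. Qed.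

Lemma eval_tlift2 (e1 : nat -> num M) e2 d t :
  eval e1 (scons d e2) (tlift2 t) = eval e1 e2 t.
Proof. unfold tlift2; rewrite eval_subst; reflexivity. Qed.

Lemma def_all1 c f (P : ctx c -> num M -> Prop) :
  DefN c f -> Def (S1 :: c) (fun v => P (fst v) (snd v)) ->
  Def c (fun v => forall d, le d (f v) -> P v d).
Proof.
  apply definable_2; intros e [t Ht] (A & HA & HP); exists (all_le t A).
  split; [constructor; assumption|]; intros v; unfold satc; cbn [sat all_le].
  split; intros H d Hd; [apply (HP (v, d)) | apply (HP (v, d))]; apply H;
    cbn [eval] in *; rewrite eval_tlift1 in *; fold (evalc v e t) in *; rewrite Ht in *;
    exact Hd.
Qed.

Lemma def_ex1 c f (P : ctx c -> num M -> Prop) :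
  DefN c f -> Def (S1 :: c) (fun v => P (fst v) (snd v)) ->
  Def c (fun v => exists d, le d (f v) /\ P v d).
Proof.
  apply definable_2; intros e [t Ht] (A & HA & HP); exists (ex_le t A).
  split; [constructor; assumption|]; intros v; unfold satc; cbn [sat ex_le].
  split; intros (d & Hd & H); exists d; (split; [|apply (HP (v, d)); exact H]);
    cbn [eval] in *; rewrite eval_tlift1 in *; fold (evalc v e t) in *; rewrite Ht in *;
    exact Hd.
Qed.

Lemma def_all2 c f (P : ctx c -> str M -> Prop) :
  DefN c f -> Def (S2 :: c) (fun v => P (fst v) (snd v)) ->
  Def c (fun v => forall X, le (len X) (f v) -> P v X).
Proof.
  apply definable_2; intros e [t Ht] (A & HA & HP); exists (all2_le t A).
  split; [constructor; assumption|]; intros v; unfold satc; cbn [sat all2_le].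
  split; intros H d Hd; [apply (HP (v, d)) | apply (HP (v, d))]; apply H;
    cbn [eval] in *; rewrite eval_tlift2 in *; fold (evalc v e t) in *; rewrite Ht in *;
    exact Hd.
Qed.

Lemma def_ex2 c f (P : ctx c -> str M -> Prop) :
  DefN c f -> Def (S2 :: c) (fun v => P (fst v) (snd v)) ->
  Def c (fun v => exists X, le (len X) (f v) /\ P v X).
Proof.
  apply definable_2; intros e [t Ht] (A & HA & HP); exists (ex2_le t A).
  split; [constructor; assumption|]; intros v; unfold satc; cbn [sat ex2_le].
  split; intros (d & Hd & H); exists d; (split; [|apply (HP (v, d)); exact H]);
    cbn [eval] in *; rewrite eval_tlift2 in *; fold (evalc v e t) in *; rewrite Ht in *;
    exact Hd.
Qed.

Lemma def_iff c (P Q : ctx c -> Prop) :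
  Def c P -> Def c Q -> Def c (fun v => P v <-> Q v).
Proof. intros HP HQ; apply def_and; apply def_imp; assumption. Qed.

Lemma def_not c (P : ctx c -> Prop) : Def c P -> Def c (fun v => ~ P v).
Proof. intros HP; apply def_imp; [assumption | apply def_const]. Qed.

Lemma def_lt c f g : DefN c f -> DefN c g -> Def c (fun v => lt (f v) (g v)).
Proof.
  intros Hf Hg; apply def_and; [apply def_le | apply def_not, def_eq1]; assumption.
Qed.

Lemma defN_const c a : DefN c (fun _ => a).
Proof.
  exists (Params (fun _ => a) (fun _ => a2) (fun _ => a3)).
  intros e ([r Hr] & _); cbn in Hr.
  assert (H : forall c, exists n, forall v : ctx c, env1 c v (par1 e) n = a).
  { clear c; induction c as [|[] c [n IH]]; simpl.
    - exists (r 0); auto.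
    - exists (S n); intros v; apply IH.
    - exists n; intros v; apply IH.
    - exists n; intros v; apply IH. }
  destruct (H c) as [n Hn]; exists (TVar n); exact Hn.
Qed.

Lemma defS_const c a : DefS c (fun _ => a).
Proof.
  exists (Params (fun _ => a1) (fun _ => a) (fun _ => a3)).
  intros e (_ & [r Hr] & _); cbn in Hr.
  induction c as [|[] c [n IH]]; simpl.
  - exists (r 0); auto.
  - exists n; intros v; apply IH.
  - exists (S n); intros v; apply IH.
  - exists n; intros v; apply IH.
Qed.

Lemma defH_const c a : DefH c (fun _ => a).
Proof.
  exists (Params (fun _ => a1) (fun _ => a2) (fun _ => a)).
  intros e (_ & _ & [r Hr]); cbn in Hr.
  induction c as [|[] c [n IH]]; simpl.
  - exists (r 0); auto.
  - exists n; intros v; apply IH.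
  - exists n; intros v; apply IH.
  - exists (S n); intros v; apply IH.
Qed.

Lemma defN_var c : DefN (S1 :: c) (fun v => snd v).
Proof. apply definable_0; intros e; exists (TVar 0); reflexivity. Qed.

Lemma defS_var c : DefS (S2 :: c) (fun v => snd v).
Proof. apply definable_0; intros e; exists 0; reflexivity. Qed.

Lemma defH_var c : DefH (S3 :: c) (fun v => snd v).
Proof. apply definable_0; intros e; exists 0; reflexivity. Qed.

Lemma defN_fst s c f : DefN c f -> DefN (s :: c) (fun v => f (fst v)).
Proof.
  apply definable_1; intros e [t Ht]; destruct s.
  - exists (tlift1 t); intros v; rewrite <- Ht; apply eval_tlift1.
  - exists (tlift2 t); intros v; rewrite <- Ht; apply eval_tlift2.
  - exists t; intros v; rewrite <- Ht; reflexivity.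
Qed.

Lemma defS_fst s c f : DefS c f -> DefS (s :: c) (fun v => f (fst v)).
Proof.
  apply definable_1; intros e [t Ht]; destruct s;
    [exists t | exists (S t) | exists t]; intros v; rewrite <- Ht; reflexivity.
Qed.

Lemma defH_fst s c f : DefH c f -> DefH (s :: c) (fun v => f (fst v)).
Proof.
  apply definable_1; intros e [t Ht]; destruct s;
    [exists t | exists t | exists (S t)]; intros v; rewrite <- Ht; reflexivity.
Qed.

Lemma defN_add c f g : DefN c f -> DefN c g -> DefN c (fun v => add (f v) (g v)).
Proof.
  apply definable_2; intros e [t Ht] [u Hu]; exists (TAdd t u).
  intros v; rewrite <- Ht, <- Hu; reflexivity.
Qed.

Lemma defN_mul c f g : DefN c f -> DefN c g -> DefN c (fun v => mul (f v) (g v)).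
Proof.
  apply definable_2; intros e [t Ht] [u Hu]; exists (TMul t u).
  intros v; rewrite <- Ht, <- Hu; reflexivity.
Qed.

Lemma defN_len c f : DefS c f -> DefN c (fun v => len (f v)).
Proof.
  apply definable_1; intros e [n Hn]; exists (TLen n).
  intros v; rewrite <- Hn; reflexivity.
Qed.

Fixpoint DefSub (c c' : list sort) : (ctx c -> ctx c') -> Prop :=
  match c' with
  | [] => fun _ => True
  | S1 :: c' => fun f => DefSub c c' (fun v => fst (f v)) /\ DefN c (fun v => snd (f v))
  | S2 :: c' => fun f => DefSub c c' (fun v => fst (f v)) /\ DefS c (fun v => snd (f v))
  | S3 :: c' => fun f => DefSub c c' (fun v => fst (f v)) /\ DefH c (fun v => snd (f v))
  end.

Definition subst_env {c c'} (f : ctx c -> ctx c') (e : params) : Prop :=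
  exists s1 r2 r3, forall v,
    env1 c' (f v) (par1 e) = (fun n => evalc v e (s1 n))
    /\ env2 c' (f v) (par2 e) = (fun n => env2 c v (par2 e) (r2 n))
    /\ env3 c' (f v) (par3 e) = (fun n => env3 c v (par3 e) (r3 n)).

Lemma subst_env_nil c (f : ctx c -> ctx []) e : subst_env f e.
Proof.
  induction c as [|s c IH].
  - exists TVar, rid, rid; intros v; repeat split.
  - destruct (IH (fun _ => tt)) as (s1 & r2 & r3 & H); destruct s.
    + exists (fun n => tlift1 (s1 n)), r2, r3; intros v.
      destruct (H (fst v)) as (H1 & H2 & H3); repeat split; try assumption.
      cbn in *; rewrite H1 at 1; extensionality n; symmetry; apply eval_tlift1.
    + exists (fun n => tlift2 (s1 n)), (fun n => S (r2 n)), r3; intros v.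
      destruct (H (fst v)) as (H1 & H2 & H3); repeat split; try assumption.
      cbn in *; rewrite H1 at 1; extensionality n; symmetry; apply eval_tlift2.
    + exists s1, r2, (fun n => S (r3 n)); intros v.
      destruct (H (fst v)) as (H1 & H2 & H3); repeat split; assumption.
Qed.

Lemma DefSub_env c c' f : DefSub c c' f -> definable (subst_env f).
Proof.
  induction c' as [|[] c' IH]; intros H.
  - apply definable_0; intros e; apply subst_env_nil.
  - destruct H as [Hf Ht]; revert Ht; generalize (IH _ Hf); apply definable_2.
    intros e (s1 & r2 & r3 & H) [t Ht]; exists (scons t s1), r2, r3; intros v.
    destruct (H v) as (H1 & H2 & H3); repeat split; try assumption.
    cbn in *; rewrite H1, <- Ht; extensionality n; destruct n; reflexivity.
  - destruct H as [Hf Ht]; revert Ht; generalize (IH _ Hf); apply definable_2.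
    intros e (s1 & r2 & r3 & H) [t Ht]; exists s1, (scons t r2), r3; intros v.
    destruct (H v) as (H1 & H2 & H3); repeat split; try assumption.
    cbn in *; rewrite H2, <- Ht; extensionality n; destruct n; reflexivity.
  - destruct H as [Hf Ht]; revert Ht; generalize (IH _ Hf); apply definable_2.
    intros e (s1 & r2 & r3 & H) [t Ht]; exists s1, r2, (scons t r3); intros v.
    destruct (H v) as (H1 & H2 & H3); repeat split; try assumption.
    cbn in *; rewrite H3, <- Ht; extensionality n; destruct n; reflexivity.
Qed.

(** Through this a relation known only to be definable can be applied to other arguments inside
    larger bounded formulas. *)
Lemma def_comp c c' P f : Def c' P -> DefSub c c' f -> Def c (fun v => P (f v)).
Proof.
  intros HP Hf; apply DefSub_env in Hf; revert HP Hf; apply definable_2.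
  intros e (A & HA & HP) (s1 & r2 & r3 & H); exists (fsubst s1 r2 r3 A).
  split; [apply SigmaBB0_fsubst, HA|]; intros v; rewrite <- HP.
  unfold satc; rewrite sat_subst; destruct (H v) as (H1 & H2 & H3).
  rewrite H1, H2, H3; reflexivity.
Qed.

Lemma def_sat phi p1 p2 p3 : SigmaBB0 phi ->
  Def [S2; S1] (fun v => sat (scons (snd (fst v)) p1) (scons (snd v) p2) p3 phi).
Proof.
  intros Hphi; exists (Params p1 p2 p3); intros e ([r1 H1] & [r2 H2] & [r3 H3]).
  cbn in H1, H2, H3.
  exists (fsubst (scons (TVar 0) (fun n => TVar (S (r1 n)))) (scons 0 (fun n => S (r2 n))) r3 phi).
  split; [apply SigmaBB0_fsubst, Hphi|]; intros v; unfold satc; rewrite sat_subst.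
  rewrite !scons_map; cbn.
  replace (fun n => par1 e (r1 n)) with p1 by (extensionality n; auto).
  replace (fun n => par2 e (r2 n)) with p2 by (extensionality n; auto).
  replace (fun n => par3 e (r3 n)) with p3 by (extensionality n; auto).
  reflexivity.
Qed.

Lemma def_all1_lt c f (P : ctx c -> num M -> Prop) :
  DefN c f -> Def (S1 :: c) (fun v => P (fst v) (snd v)) ->
  Def c (fun v => forall d, lt d (f v) -> P v d).
Proof.
  intros Hf HP.
  apply def_ext with (fun v => forall d, le d (f v) -> lt d (f v) -> P v d).
  { intros v; split; intros H d Hd; [apply H; [apply Hd | exact Hd] | apply H]. }
  apply def_all1; [exact Hf|]; apply def_imp; [|exact HP].
  apply def_lt; [apply defN_var | apply defN_fst, Hf].
Qed.

Lemma def_ex1_lt c f (P : ctx c -> num M -> Prop) :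
  DefN c f -> Def (S1 :: c) (fun v => P (fst v) (snd v)) ->
  Def c (fun v => exists d, lt d (f v) /\ P v d).
Proof.
  intros Hf HP.
  apply def_ext with (fun v => exists d, le d (f v) /\ lt d (f v) /\ P v d).
  { intros v; split; [intros (d & _ & H); exists d; exact H|].
    intros (d & Hd & H); exists d; repeat split; try assumption; apply Hd. }
  apply def_ex1; [exact Hf|]; apply def_and; [|exact HP].
  apply def_lt; [apply defN_var | apply defN_fst, Hf].
Qed.

Lemma def_app_NS c (R : num M -> str M -> Prop) f g :
  Def [S2; S1] (fun v => R (snd (fst v)) (snd v)) -> DefN c f -> DefS c g ->
  Def c (fun v => R (f v) (g v)).
Proof.
  intros HR Hf Hg.
  apply (def_comp _ [S2; S1] _ (fun v => (tt, f v, g v)) HR); repeat split; assumption.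
Qed.

Lemma def_app_S c (R : str M -> Prop) f :
  Def [S2] (fun v => R (snd v)) -> DefS c f -> Def c (fun v => R (f v)).
Proof.
  intros HR Hf; apply (def_comp _ [S2] _ (fun v => (tt, f v)) HR); repeat split; assumption.
Qed.

Lemma def_app_SS c (R : str M -> str M -> Prop) f g :
  Def [S2; S2] (fun v => R (snd (fst v)) (snd v)) -> DefS c f -> DefS c g ->
  Def c (fun v => R (f v) (g v)).
Proof.
  intros HR Hf Hg.
  apply (def_comp _ [S2; S2] _ (fun v => (tt, f v, g v)) HR); repeat split; assumption.
Qed.

Lemma def_app_SSS c (R : str M -> str M -> str M -> Prop) f g h :
  Def [S2; S2; S2] (fun v => R (snd (fst (fst v))) (snd (fst v)) (snd v)) ->
  DefS c f -> DefS c g -> DefS c h -> Def c (fun v => R (f v) (g v) (h v)).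
Proof.
  intros HR Hf Hg Hh.
  apply (def_comp _ [S2; S2; S2] _ (fun v => (tt, f v, g v, h v)) HR); repeat split; assumption.
Qed.

(** * Automation of definability proofs *)

Definition inhabitant (s : sort) : dom s :=
  match s with S1 => a1 | S2 => a2 | S3 => a3 end.

(** A value that ignores the innermost variable is recognized by plugging an arbitrary element into
    its place; if it does depend on that variable, the unification that follows fails. *)
Ltac drop_last s c f :=
  let g := constr:(fun w : ctx c => f (w, inhabitant s)) in
  eval cbn [fst snd] in g.

Ltac def_weaken :=
  lazymatch goal with
  | |- DefN (?s :: ?c) ?f => let g := drop_last s c f in apply (defN_fst s c g)
  | |- DefS (?s :: ?c) ?f => let g := drop_last s c f in apply (defS_fst s c g)
  | |- DefH (?s :: ?c) ?f => let g := drop_last s c f in apply (defH_fst s c g)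
  end.

Ltac def_val :=
  first
    [ assumption
    | apply defN_const | apply defS_const | apply defH_const
    | exact (defN_var _) | exact (defS_var _) | exact (defH_var _)
    | def_weaken; def_val
    | apply defN_add; def_val | apply defN_mul; def_val | apply defN_len; def_val ].

(** A hook, redefined once the compound notions on strings have been shown to be definable. *)
Ltac def_user := fail.

Ltac def_tac :=
  cbv beta;
  lazymatch goal with
  | |- Def _ _ =>
    first
      [ apply def_const
      | solve [ def_user ]
      | apply def_iff; def_tac | apply def_not; def_tac | apply def_lt; def_val
      | apply def_and; def_tac | apply def_or; def_tac | apply def_imp; def_tac
      | apply def_all1_lt; def_tac | apply def_ex1_lt; def_tac
      | apply def_all1; def_tac | apply def_ex1; def_tac
      | apply def_all2; def_tac | apply def_ex2; def_tac
      | apply def_eq1; def_val | apply def_eq2; def_val | apply def_le; def_val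
      | apply def_bit; def_val | apply def_mem; def_val ]
  | |- _ => def_val
  end.

(** * Arithmetic in a model of W^1_1 *)

Hypothesis HM : models M W11.

Declare Scope num_scope.
Delimit Scope num_scope with num.
Local Notation "0" := (@zero M) : num_scope.
Local Notation "1" := (@one M) : num_scope.
Local Notation "a + b" := (@add M a b) : num_scope.
Local Notation "a * b" := (@mul M a b) : num_scope.
Local Notation "a <= b" := (@le M a b) : num_scope.
Local Notation "a < b" := (lt a b) : num_scope.
Local Open Scope num_scope.

(** * Semantic forms of the axioms *)

Lemma basic A : BASIC A -> forall (a b : num M) X Y,
  sat (scons a (fun _ => b)) (scons X (fun _ => Y)) (fun _ => a3) A.
Proof. intros HA a b X Y; apply HM, W11_BASIC, HA. Qed.

Lemma induction_hyp (P : num M -> hyp M -> Prop) :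
  Def [S3; S1] (fun v => P (snd (fst v)) (snd v)) ->
  (exists Z, P 0 Z) -> (forall n, (exists Z, P n Z) -> exists Z, P (n + 1) Z) ->
  forall n, exists Z, P n Z.
Proof.
  intros [e He] H0 HS.
  destruct (He e (pcovers_refl e)) as (A & HA & HP).
  pose proof (HM _ (W11_IND _ (SBB1_ex3 _ HA)) (par1 e) (par2 e) (par3 e)) as H.
  unfold IND, inst1 in H; cbn [sat] in H; rewrite sat_subst in H.
  assert (HP' : forall n e1, e1 = scons n (par1 e) ->
     sat e1 (par2 e) (par3 e) (FEx3 A) <-> exists Z, P n Z).
  { intros n e1 ->; split; intros [Z HZ]; exists Z; apply (HP (tt, n, Z)); exact HZ. }
  intros n; apply (HP' n _ eq_refl), H; split.
  - apply (HP' 0); [extensionality i; destruct i; reflexivity | exact H0].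
  - intros d Hd; rewrite sat_subst; apply (HP' (d + 1));
      [extensionality i; destruct i; reflexivity|].
    apply HS, (HP' d _ eq_refl), Hd.
Qed.

Lemma induction_num (P : num M -> Prop) :
  Def [S1] (fun v => P (snd v)) ->
  P 0 -> (forall n, P n -> P (n + 1)) -> forall n, P n.
Proof.
  (* The induction axiom speaks of formulas with a leading hyper string quantifier, so a bounded
     property is given a vacuous one, witnessed by [a3]. *)
  intros HP H0 HS n; destruct (induction_hyp (fun n _ => P n)) with (n := n) as [_ H];
    [ | exists a3; exact H0 | intros m [_ Hm]; exists a3; apply HS, Hm | exact H].
  apply (def_comp [S3; S1] [S1] _ (fun v => (tt, snd (fst v))) HP); repeat split; def_tac.
Qed.

Lemma comprehension_str (P : num M -> Prop) b :
  Def [S1] (fun v => P (snd v)) ->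
  exists X, len X <= b /\ forall d, d < b -> (bit X d <-> P d).
Proof.
  intros HP.
  (* In the comprehension axiom the bound is number variable 1 of the formula, so the predicate is
     moved to a context with a slot for it. *)
  assert (HP2 : Def [S1; S1] (fun v => P (snd v)))
    by (apply (def_comp [S1; S1] [S1] _ (fun v => (tt, snd v)) HP); repeat split; def_tac).
  destruct HP2 as [e He].
  destruct (He e (pcovers_refl e)) as (A & HA & HA').
  pose proof (HM _ (W11_COMP2 _ HA) (par1 e) (par2 e) (par3 e) b) as (X & HX & H).
  exists X; split; [exact HX|]; intros d Hd.
  specialize (H d (proj1 Hd) Hd); cbn [sat FIff] in H; unfold lift2 in H; rewrite sat_subst in H.
  specialize (HA' (tt, b, d)); cbn in HA'; rewrite <- HA'; exact H.
Qed.

Lemma comprehension_hyp (P : str M -> Prop) b :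
  Def [S2] (fun v => P (snd v)) ->
  exists Z, forall X, len X <= b -> (mem Z X <-> P X).
Proof.
  intros HP.
  assert (HP2 : Def [S2; S1] (fun v => P (snd v)))
    by (apply (def_comp [S2; S1] [S2] _ (fun v => (tt, snd v)) HP); repeat split; def_tac).
  destruct HP2 as [e He].
  destruct (He e (pcovers_refl e)) as (A & HA & HA').
  pose proof (HM _ (W11_COMP3 _ HA) (par1 e) (par2 e) (par3 e) b) as (Z & H).
  exists Z; intros X HX.
  specialize (H X HX); cbn [sat FIff] in H; unfold lift3 in H; rewrite sat_subst in H.
  specialize (HA' (tt, b, X)); cbn in HA'; rewrite <- HA'; exact H.
Qed.

Lemma succ_neq_0 a : a + 1 <> 0.
Proof. exact (basic _ B1 a a a2 a2). Qed.

Lemma succ_inj a b : a + 1 = b + 1 -> a = b.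
Proof. exact (basic _ B2 a b a2 a2). Qed.

Lemma add_0_r a : a + 0 = a.
Proof. exact (basic _ B3 a a a2 a2). Qed.

Lemma add_succ_r a b : a + (b + 1) = (a + b) + 1.
Proof. exact (basic _ B4 a b a2 a2). Qed.

Lemma mul_0_r a : a * 0 = 0.
Proof. exact (basic _ B5 a a a2 a2). Qed.

Lemma mul_succ_r a b : a * (b + 1) = a * b + a.
Proof. exact (basic _ B6 a b a2 a2). Qed.

Lemma le_antisym a b : a <= b -> b <= a -> a = b.
Proof. intros H H'; exact (basic _ B7 a b a2 a2 (conj H H')). Qed.

Lemma le_add_r a b : a <= a + b.
Proof. exact (basic _ B8 a b a2 a2). Qed.

Lemma le_0_l a : 0 <= a.
Proof. exact (basic _ B9 a a a2 a2). Qed.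

Lemma le_total a b : a <= b \/ b <= a.
Proof. exact (basic _ B10 a b a2 a2). Qed.

Lemma le_iff_lt_succ a b : a <= b <-> a < b + 1.
Proof. exact (basic _ B11 a b a2 a2). Qed.

Lemma pred_ex a : a <> 0 -> exists b, b + 1 = a.
Proof. intros H; destruct (basic _ B12 a a a2 a2 H) as (b & _ & Hb); exists b; exact Hb. Qed.

Ltac num_induction :=
  match goal with |- forall n, @?P n => refine (induction_num P _ _ _) end; cbv beta.

Ltac ind n := revert n; num_induction; [def_tac | | intros n IH].

Lemma add_assoc a b c : a + (b + c) = (a + b) + c.
Proof.
  ind c; [rewrite !add_0_r; reflexivity|].
  rewrite !add_succ_r, IH; reflexivity.
Qed.

Lemma add_0_l a : 0 + a = a.
Proof. ind a; [apply add_0_r | rewrite add_succ_r, IH; reflexivity]. Qed.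

Lemma add_succ_l a b : (a + 1) + b = (a + b) + 1.
Proof. ind b; [rewrite !add_0_r; reflexivity | rewrite !add_succ_r, IH; reflexivity]. Qed.

Lemma add_comm a b : a + b = b + a.
Proof.
  ind b; [rewrite add_0_r, add_0_l; reflexivity|].
  rewrite add_succ_r, add_succ_l, IH; reflexivity.
Qed.

Lemma mul_0_l a : 0 * a = 0.
Proof. ind a; [apply mul_0_r | rewrite mul_succ_r, IH; apply add_0_r]. Qed.

Lemma mul_succ_l a b : (a + 1) * b = a * b + b.
Proof.
  ind b; [rewrite !mul_0_r, add_0_r; reflexivity|].
  rewrite !mul_succ_r, IH, !add_assoc; f_equal.
  rewrite <- !add_assoc, (add_comm b a); reflexivity.
Qed.

Lemma mul_comm a b : a * b = b * a.
Proof.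
  ind b; [rewrite mul_0_r, mul_0_l; reflexivity|].
  rewrite mul_succ_r, mul_succ_l, IH; reflexivity.
Qed.

Lemma mul_1_l a : 1 * a = a.
Proof. rewrite <- (add_0_l 1), mul_succ_l, mul_0_l; apply add_0_l. Qed.

Lemma mul_add_distr_r a b c : (a + b) * c = a * c + b * c.
Proof.
  ind c; [rewrite !mul_0_r, add_0_r; reflexivity|].
  rewrite !mul_succ_r, IH, <- !add_assoc; f_equal.
  rewrite !add_assoc, (add_comm a); reflexivity.
Qed.

Lemma mul_assoc a b c : a * (b * c) = (a * b) * c.
Proof.
  ind c; [rewrite !mul_0_r; reflexivity|].
  rewrite !mul_succ_r, (mul_comm a), mul_add_distr_r, <- IH.
  rewrite (mul_comm (b * c)), (mul_comm b a); reflexivity.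
Qed.

Lemma num_semi_ring : semi_ring_theory 0 1 add mul eq.
Proof.
  constructor; auto using add_0_l, add_comm, add_assoc, mul_1_l, mul_0_l, mul_comm,
    mul_assoc, mul_add_distr_r.
Qed.

Add Ring num_ring : num_semi_ring.

(** The bound [c <= b] keeps the statement a bounded formula, so that induction applies to it.
    Afterwards order facts reduce to explicit differences checked by [ring]. *)
Lemma le_ex a b : a <= b -> exists c, c <= b /\ b = a + c.
Proof.
  ind b.
  - intros H; exists 0; split; [apply le_0_l|].
    rewrite add_0_r; apply le_antisym; [apply le_0_l | exact H].
  - intros H; destruct (classic (a = b + 1)) as [->|Hn].
    + exists 0; split; [apply le_0_l | ring].
    + destruct IH as (c & _ & Hc); [apply le_iff_lt_succ; split; assumption|].
      exists (c + 1); split; [|rewrite Hc; ring].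
      replace (b + 1) with (c + 1 + a) by (rewrite Hc; ring); apply le_add_r.
Qed.

Lemma le_iff a b : a <= b <-> exists c, b = a + c.
Proof.
  split; [intros H; destruct (le_ex _ _ H) as (c & _ & Hc); exists c; exact Hc|].
  intros [c ->]; apply le_add_r.
Qed.

Lemma add_cancel_r a b c : a + c = b + c -> a = b.
Proof.
  ind c; [rewrite !add_0_r; auto|].
  rewrite !add_succ_r; intros H; apply IH, succ_inj, H.
Qed.

Lemma add_cancel_l a b c : c + a = c + b -> a = b.
Proof. rewrite !(add_comm c); apply add_cancel_r. Qed.

Lemma lt_iff a b : a < b <-> exists c, b = a + 1 + c.
Proof.
  split.
  - intros [H Hn]; apply le_iff in H; destruct H as [c ->].
    destruct (pred_ex c) as [d <-]; [intros ->; apply Hn; symmetry; apply add_0_r|].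
    exists d; ring.
  - intros [c ->]; split; [apply le_iff; exists (1 + c); ring|].
    intros H; apply (succ_neq_0 c), (add_cancel_l _ _ a).
    rewrite add_0_r; rewrite H at 2; ring.
Qed.

Lemma le_refl a : a <= a.
Proof. apply le_iff; exists 0; ring. Qed.

Lemma le_trans a b c : a <= b -> b <= c -> a <= c.
Proof. rewrite !le_iff; intros [d ->] [e ->]; exists (d + e); ring. Qed.

Lemma lt_le_trans a b c : a < b -> b <= c -> a < c.
Proof. rewrite !lt_iff, le_iff; intros [d ->] [e ->]; exists (d + e); ring. Qed.

Lemma le_lt_trans a b c : a <= b -> b < c -> a < c.
Proof. rewrite !lt_iff, le_iff; intros [d ->] [e ->]; exists (d + e); ring. Qed.

Lemma lt_le_incl a b : a < b -> a <= b.
Proof. intros [H _]; exact H. Qed.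

Lemma lt_trans a b c : a < b -> b < c -> a < c.
Proof. intros H; apply le_lt_trans, lt_le_incl, H. Qed.

Lemma lt_irrefl a : ~ a < a.
Proof. intros [_ H]; apply H; reflexivity. Qed.

Lemma le_not_lt a b : a <= b -> ~ b < a.
Proof. intros H H'; apply (lt_irrefl a), le_lt_trans with b; assumption. Qed.

Lemma le_or_lt a b : a <= b \/ b < a.
Proof.
  destruct (le_total a b) as [H|H]; [left; exact H|].
  destruct (classic (b = a)) as [->|Hn]; [left; exact H | right; split; assumption].
Qed.

Lemma lt_succ_r a b : a < b + 1 <-> a <= b.
Proof. rewrite le_iff_lt_succ; reflexivity. Qed.

Lemma lt_succ_diag a : a < a + 1.
Proof. apply lt_succ_r, le_refl. Qed.

Lemma lt_succ_cases a b : a < b + 1 <-> a < b \/ a = b.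
Proof.
  rewrite lt_succ_r; split.
  - intros H; destruct (classic (a = b)); [right; assumption | left; split; assumption].
  - intros [[H _]| ->]; [exact H | apply le_refl].
Qed.

Lemma lt_neq a b : a < b -> a <> b.
Proof. intros [_ H]; exact H. Qed.

Lemma nlt_0_r a : ~ a < 0.
Proof. apply le_not_lt, le_0_l. Qed.

Lemma add_le_mono_l a b c : a <= b -> c + a <= c + b.
Proof. rewrite !le_iff; intros [d ->]; exists d; ring. Qed.

Lemma add_lt_mono_l a b c : a < b -> c + a < c + b.
Proof. rewrite !lt_iff; intros [d ->]; exists d; ring. Qed.

Lemma le_add_l a b : a <= b + a.
Proof. rewrite add_comm; apply le_add_r. Qed.

Lemma le_succ_diag a : a <= a + 1.
Proof. apply le_add_r. Qed.

Lemma lt_succ_le a b : a < b -> a + 1 <= b.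
Proof. rewrite lt_iff, le_iff; auto. Qed.

(** * Strings as finite sets *)

Local Notation "| X |" := (@len M X) (at level 35, X at level 30) : num_scope.
Local Notation bit := (@bit M).
Local Notation mem := (@mem M).

Lemma bit_lt X d : bit X d -> d < |X|.
Proof. exact (basic _ L1 d d X X). Qed.

Lemma bit_last X d : d + 1 = |X| -> bit X d.
Proof. exact (basic _ L2 d d X X). Qed.

(** L1 and L2 together make the length the least strict upper bound of a set; from here on lengths
    are handled through bits. *)
Lemma len_le X k : |X| <= k <-> forall d, bit X d -> d < k.
Proof.
  split.
  - intros H d Hd; apply lt_le_trans with (|X|); [apply bit_lt, Hd | exact H].
  - intros H; destruct (le_or_lt (|X|) k) as [Hk|Hk]; [exact Hk|].
    apply lt_iff in Hk; destruct Hk as [c Hc].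
    exfalso; apply (le_not_lt k (k + c)); [apply le_add_r | apply H, bit_last].
    rewrite Hc; ring.
Qed.

Lemma str_ext X Y : (forall d, bit X d <-> bit Y d) -> X = Y.
Proof.
  intros H; apply (basic _ SE 0 0 X Y); cbn.
  assert (HL : |X| = |Y|).
  { apply le_antisym; apply len_le; intros d Hd; apply bit_lt, H, Hd. }
  split; [exact HL|].
  intros d _ _; split; apply H.
Qed.

Lemma str_ex (P : num M -> Prop) b :
  Def [S1] (fun v => P (snd v)) -> (forall d, P d -> d < b) ->
  exists X, forall d, bit X d <-> P d.
Proof.
  intros HP Hb; destruct (comprehension_str P b HP) as (X & HX & H).
  exists X; intros d; split; intros Hd.
  - apply H; [|exact Hd]; rewrite len_le in HX; auto.
  - apply H; [apply Hb|]; exact Hd.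
Qed.

Lemma len_0 X : |X| <= 0 <-> forall d, ~ bit X d.
Proof.
  rewrite len_le; split; intros H d Hd; [apply (nlt_0_r d)|]; apply H in Hd; tauto.
Qed.

Lemma len_0_eq X Y : |X| <= 0 -> |Y| <= 0 -> X = Y.
Proof.
  rewrite !len_0; intros HX HY; apply str_ext; intros d.
  specialize (HX d); specialize (HY d); tauto.
Qed.

Lemma empty_ex : exists X, |X| <= 0.
Proof.
  destruct (comprehension_str (fun _ => False) 0) as (X & HX & _); [def_tac|].
  exists X; exact HX.
Qed.

(** [U] is the binary number [2^k + L], where [L < 2^k]. *)
Definition top (k : num M) (L U : str M) : Prop :=
  |L| <= k /\ forall d, bit U d <-> bit L d \/ d = k.

(** [top] quantifies over all positions, which no bounded formula can do directly. Nothing happens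
    from [k + 1] on, so the positions can be bounded; [ones] and [succ] are treated in the same
    way. *)
Lemma top_bounded k L U :
  top k L U
  <-> |L| <= k /\ |U| <= k + 1 /\ forall d, d < k + 1 -> (bit U d <-> bit L d \/ d = k).
Proof.
  split.
  - intros [HL HU]; repeat split; try assumption; try apply HU.
    apply len_le; intros d Hd; apply HU in Hd; destruct Hd as [Hd| ->].
    + rewrite len_le in HL; apply lt_trans with k; [auto | apply lt_succ_diag].
    + apply lt_succ_diag.
  - intros (HL & HU & H); split; [exact HL|]; intros d; rewrite len_le in HL, HU.
    destruct (classic (d < k + 1)) as [Hd|Hd]; [apply H, Hd|].
    split; [intros Hb; exfalso; auto|].
    intros [Hb| ->]; exfalso; apply Hd; [|apply lt_succ_diag].
    apply lt_trans with k; [auto | apply lt_succ_diag].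
Qed.

Lemma def_top c k L U : DefN c k -> DefS c L -> DefS c U ->
  Def c (fun v => top (k v) (L v) (U v)).
Proof.
  intros; eapply def_ext; [intros v; symmetry; apply top_bounded|]; def_tac.
Qed.

Lemma top_len k L U : top k L U -> |U| <= k + 1.
Proof. intros H; apply top_bounded in H; apply H. Qed.

Lemma top_bit k L U : top k L U -> bit U k.
Proof. intros [_ H]; apply H; right; reflexivity. Qed.

Lemma bit_not_len U k : bit U k -> ~ |U| <= k.
Proof. rewrite len_le; intros H HU; apply (lt_irrefl k), HU, H. Qed.

Lemma top_inj k L L' U : top k L U -> top k L' U -> L = L'.
Proof.
  intros [HL H] [HL' H']; rewrite len_le in HL, HL'; apply str_ext; intros d.
  specialize (H d); rewrite (H' d) in H.
  split; intros Hd.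
  - destruct (proj2 H (or_introl Hd)) as [?| ->]; [assumption | exfalso].
    apply (lt_irrefl k); auto.
  - destruct (proj1 H (or_introl Hd)) as [?| ->]; [assumption | exfalso].
    apply (lt_irrefl k); auto.
Qed.

Lemma top_ex k L : |L| <= k -> exists U, top k L U.
Proof.
  intros HL; destruct (str_ex (fun d => bit L d \/ d = k) (k + 1)) as [U HU].
  - def_tac.
  - rewrite len_le in HL; intros d [Hd| ->]; [|apply lt_succ_diag].
    apply lt_trans with k; [auto | apply lt_succ_diag].
  - exists U; split; assumption.
Qed.

Lemma low_ex k U : exists L, |L| <= k /\ forall d, bit L d <-> bit U d /\ d < k.
Proof.
  destruct (str_ex (fun d => bit U d /\ d < k) k) as [L HL]; [def_tac | tauto|].
  exists L; split; [|exact HL]; apply len_le; intros d Hd; apply HL, Hd.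
Qed.

Lemma len_succ_cases k U : |U| <= k + 1 -> |U| <= k \/ exists L, top k L U.
Proof.
  intros HU; destruct (classic (bit U k)) as [Hk|Hk].
  - right; destruct (low_ex k U) as (L & HL & H); exists L; split; [exact HL|].
    intros d; rewrite H; rewrite len_le in HU.
    split; [|intros [[Hd _]| ->]; assumption].
    intros Hd; destruct (proj1 (lt_succ_cases d k) (HU d Hd)); tauto.
  - left; rewrite len_le in *; intros d Hd.
    destruct (proj1 (lt_succ_cases d k) (HU d Hd)) as [?| ->]; [assumption | contradiction].
Qed.

(** [O] is the binary number [2^k - 1]. *)
Definition ones (k : num M) (O : str M) : Prop := forall d, bit O d <-> d < k.

Lemma ones_len k O : ones k O -> |O| <= k.
Proof. intros H; apply len_le; intros d; apply H. Qed.

Lemma def_ones c k O : DefN c k -> DefS c O -> Def c (fun v => ones (k v) (O v)).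
Proof.
  intros Hk HO.
  apply def_ext with (fun v => |O v| <= k v /\ forall d, d < k v -> bit (O v) d); [|def_tac].
  intros v; rewrite len_le; split.
  - intros [H1 H2] d; split; auto.
  - intros H; split; intros d; apply H.
Qed.

Lemma ones_ex k : exists O, ones k O.
Proof. apply str_ex with (b := k); [def_tac | auto]. Qed.

Lemma ones_eq k O O' : ones k O -> ones k O' -> O = O'.
Proof. intros H H'; apply str_ext; intros d; rewrite (H d), (H' d); reflexivity. Qed.

(** In binary values, 2^(k+1) - 1 = 2^k + (2^k - 1). *)
Lemma ones_succ k O O' : ones k O -> ones (k + 1) O' -> top k O O'.
Proof.
  intros H H'; split; [apply ones_len, H|]; intros d.
  rewrite (H d), (H' d); apply lt_succ_cases.
Qed.

(** [U'] is the binary successor of [U]. *)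
Definition succ (U U' : str M) : Prop :=
  forall i, bit U' i <->
    (bit U i /\ exists j, j < i /\ ~ bit U j) \/ (~ bit U i /\ forall j, j < i -> bit U j).

Lemma succ_bounded U U' :
  succ U U' <-> forall i, i < |U| + |U'| + 1 -> (bit U' i <->
    (bit U i /\ exists j, j < i /\ ~ bit U j) \/ (~ bit U i /\ forall j, j < i -> bit U j)).
Proof.
  split; [intros H i _; apply H|].
  intros H i; destruct (le_or_lt (|U| + |U'| + 1) i) as [Hi|Hi]; [|apply H, Hi].
  assert (HU : |U| < i).
  { apply lt_le_trans with (2 := Hi), lt_succ_r, le_add_r. }
  assert (HU' : |U'| < i).
  { apply lt_le_trans with (2 := Hi), lt_succ_r, le_add_l. }
  split; intros Hb.
  - exfalso; apply (lt_irrefl i), lt_trans with (|U'|); [apply bit_lt, Hb | exact HU'].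
  (* Past both lengths the second alternative would require [U] to contain its own length. *)
  - exfalso; destruct Hb as [[Hb _]|[_ Hb]].
    + apply (lt_irrefl i), lt_trans with (|U|); [apply bit_lt, Hb | exact HU].
    + apply (lt_irrefl (|U|)), bit_lt, Hb, HU.
Qed.

Lemma def_succ c U U' : DefS c U -> DefS c U' -> Def c (fun v => succ (U v) (U' v)).
Proof.
  intros; eapply def_ext; [intros v; symmetry; apply succ_bounded|]; def_tac.
Qed.

Ltac def_user ::=
  first
    [ apply def_top; def_val
    | apply def_ones; def_val
    | apply def_succ; def_val
    | match goal with
      | H : Def [S2] (fun v => ?R _) |- Def _ (fun v => ?R _) =>
          apply (def_app_S _ R _ H); def_val
      | H : Def [S2; S2] (fun v => ?R _ _) |- Def _ (fun v => ?R _ _) =>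
          apply (def_app_SS _ R _ _ H); def_val
      | H : Def [S2; S2; S2] (fun v => ?R _ _ _) |- Def _ (fun v => ?R _ _ _) =>
          apply (def_app_SSS _ R _ _ _ H); def_val
      | H : Def [S2; S1] (fun v => ?R _ _) |- Def _ (fun v => ?R _ _) =>
          apply (def_app_NS _ R _ _ H); def_val
      end ].

(** * Hyper strings as ternary relations on short strings *)

(** [W] is the concatenation of [Y], [U] and [V] as blocks of [N] bits. *)
Definition code (N : num M) (W Y U V : str M) : Prop :=
  forall i, i < N ->
    (bit W i <-> bit Y i) /\ (bit W (N + i) <-> bit U i) /\ (bit W (N + N + i) <-> bit V i).

(** A hyper string is a set of single strings, so triples are stored as concatenations. The bound on
    [W] keeps the relation bounded. *)
Definition rel (N : num M) (Z : hyp M) (Y U V : str M) : Prop :=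
  exists W, |W| <= N + N + N /\ code N W Y U V /\ mem Z W.

Lemma code_ex N Y U V : exists W, |W| <= N + N + N /\ code N W Y U V.
Proof.
  destruct (comprehension_str (fun d =>
    (d < N /\ bit Y d) \/ (exists i, i < N /\ d = N + i /\ bit U i)
    \/ (exists i, i < N /\ d = N + N + i /\ bit V i)) (N + N + N)) as (W & HW & H).
  { def_tac. }
  exists W; split; [exact HW|]; intros i Hi.
  assert (H1 : i < N + N + N) by
    (apply lt_le_trans with N; [exact Hi | rewrite <- add_assoc; apply le_add_r]).
  assert (H2 : N + i < N + N + N) by
    (apply lt_le_trans with (N + N); [apply add_lt_mono_l, Hi | apply le_add_r]).
  assert (H3 : N + N + i < N + N + N) by apply add_lt_mono_l, Hi.
  assert (HN : forall j, ~ N + j < N) by (intros j; apply le_not_lt, le_add_r).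
  repeat split; intros Hb.
  - apply H in Hb; [|exact H1]; destruct Hb as [[_ Hb]|[(j & _ & -> & _)|(j & _ & -> & _)]].
    + exact Hb.
    + exfalso; apply (HN _ Hi).
    + exfalso; rewrite <- add_assoc in Hi; apply (HN _ Hi).
  - apply H; [exact H1|]; left; split; assumption.
  - apply H in Hb; [|exact H2]; destruct Hb as [[Hb _]|[(j & _ & Hj & Hb)|(j & _ & Hj & _)]].
    + exfalso; apply (HN _ Hb).
    + apply add_cancel_l in Hj; subst; exact Hb.
    + rewrite <- add_assoc in Hj; apply add_cancel_l in Hj; subst.
      exfalso; apply (HN _ Hi).
  - apply H; [exact H2|]; right; left; exists i; repeat split; assumption || apply Hi.
  - apply H in Hb; [|exact H3]; destruct Hb as [[Hb _]|[(j & Hj' & Hj & _)|(j & _ & Hj & Hb)]].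
    + exfalso; rewrite <- add_assoc in Hb; apply (HN _ Hb).
    + rewrite <- add_assoc in Hj; apply add_cancel_l in Hj; subst.
      exfalso; apply (HN _ Hj').
    + apply add_cancel_l in Hj; subst; exact Hb.
  - apply H; [exact H3|]; right; right; exists i; repeat split; assumption || apply Hi.
Qed.

Lemma bits_eq N X Y :
  |X| <= N -> |Y| <= N -> (forall i, i < N -> (bit X i <-> bit Y i)) -> X = Y.
Proof.
  rewrite !len_le; intros HX HY H; apply str_ext; intros d.
  split; intros Hd; apply H; auto.
Qed.

Lemma rel_comprehension N (P : str M -> str M -> str M -> Prop) :
  Def [S2; S2; S2] (fun v => P (snd (fst (fst v))) (snd (fst v)) (snd v)) ->
  exists Z, forall Y U V, |Y| <= N -> |U| <= N -> |V| <= N -> (rel N Z Y U V <-> P Y U V).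
Proof.
  intros HP.
  destruct (comprehension_hyp (fun W => exists Y, |Y| <= N /\ exists U, |U| <= N /\
    exists V, |V| <= N /\ code N W Y U V /\ P Y U V) (N + N + N)) as [Z HZ].
  { unfold code; do 3 (apply def_ex2; [def_tac|]).
    apply def_and; [def_tac | apply (def_app_SSS _ P _ _ _ HP); def_tac]. }
  exists Z; intros Y U V HY HU HV; split.
  - intros (W & HW & HC & HM'); apply HZ in HM'; [|exact HW].
    destruct HM' as (Y' & HY' & U' & HU' & V' & HV' & HC' & HP').
    replace Y with Y'; [replace U with U'; [replace V with V'; [exact HP'|]|]|];
      apply bits_eq with N; try assumption; intros i Hi;
      destruct (HC i Hi) as (E1 & E2 & E3), (HC' i Hi) as (E1' & E2' & E3');
      [rewrite <- E3, E3' | rewrite <- E2, E2' | rewrite <- E1, E1']; reflexivity.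
  - intros H; destruct (code_ex N Y U V) as (W & HW & HC).
    exists W; repeat (split; [assumption|]); apply HZ; [exact HW|].
    exists Y; split; [exact HY|]; exists U; split; [exact HU|]; exists V; auto.
Qed.

(** * Iteration by repeated doubling *)

(** [r Y U V]: the value at [V] of the [U]-th iterate of [F] at [Y], where [F] is a
    function on strings of length at most [x], and [U < 2^n]. *)
Definition Iter (x n : num M) (F : str M -> str M -> Prop)
    (r : str M -> str M -> str M -> Prop) : Prop :=
  (forall U, |U| <= 0 -> forall Y, |Y| <= x -> forall V, |V| <= x -> (r Y U V <-> Y = V))
  /\ forall k, k < n -> forall L, |L| <= k -> forall U, |U| <= k + 1 -> top k L U ->
     forall Y, |Y| <= x -> forall V, |V| <= x ->
     (r Y U V <->
      exists A, |A| <= x /\ exists B, |B| <= x /\ exists O, |O| <= k /\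
        ones k O /\ r Y O A /\ F A B /\ r B L V).

Lemma iter_ex x n F :
  Def [S2; S2] (fun v => F (snd (fst v)) (snd v)) ->
  exists r, Def [S2; S2; S2] (fun v => r (snd (fst (fst v))) (snd (fst v)) (snd v))
            /\ Iter x n F r.
Proof.
  intros HF.
  assert (Hx : x <= x + n) by apply le_add_r.
  assert (Hn : n <= x + n) by apply le_add_l.
  (* Blocks of length [x + n] have room both for values, of length at most [x], and for exponents,
     of length at most [n]. *)
  revert Hx Hn; generalize (x + n); intros N Hx Hn.
  (* [Iter] is bounded in the relation, so this is one hyper string quantifier before a bounded
     formula. The guard [m <= N] is there because induction runs over all numbers while exponents
     must fit into a block. *)
  assert (H : forall m, exists Z, m <= N -> Iter x m F (rel N Z)).
  { apply induction_hyp.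
    - unfold Iter, rel, code; def_tac.
    - destruct (rel_comprehension N (fun Y U V => Y = V)) as [Z HZ]; [def_tac|].
      exists Z; intros _; split.
      + intros U HU Y HY V HV; apply HZ; [| |]; eapply le_trans; eauto using le_0_l.
      + intros k Hk; exfalso; apply (nlt_0_r k), Hk.
    - intros m [Z IH].
      destruct (classic (m + 1 <= N)) as [HmN|HmN]; [|exists Z; tauto].
      assert (Hm : m <= N) by (apply le_trans with (m + 1); [apply le_succ_diag | exact HmN]).
      destruct (IH Hm) as [IH0 IH1]; clear IH.
      (* Exponents of length at most [m] keep their values; those with top bit [m] get the
         composition, computed from the old relation. The clauses cannot clash, since a string
         containing [m] is longer than [m]. *)
      destruct (rel_comprehension N (fun Y U V =>
        (|U| <= m /\ rel N Z Y U V)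
        \/ exists L, |L| <= m /\ top m L U /\
           exists A, |A| <= x /\ exists B, |B| <= x /\ exists O, |O| <= m /\
             ones m O /\ rel N Z Y O A /\ F A B /\ rel N Z B L V)) as [Z' HZ'].
      { unfold rel, code; def_tac. }
      assert (Hsmall : forall Y U V, |Y| <= x -> |U| <= m -> |V| <= x ->
                (rel N Z' Y U V <-> rel N Z Y U V)).
      { intros Y U V HY HU HV; rewrite HZ' by eauto using le_trans.
        split; [|left; split; assumption].
        intros [[_ H]|(L & _ & HL & _)]; [exact H|].
        exfalso; exact (bit_not_len _ _ (top_bit _ _ _ HL) HU). }
      exists Z'; intros _; split.
      + intros U HU Y HY V HV; rewrite Hsmall; try assumption.
        * apply IH0; assumption.
        * apply le_trans with 0; [exact HU | apply le_0_l].
      + intros k Hk L HL U HU HT Y HY V HV.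
        apply lt_succ_cases in Hk; destruct Hk as [Hk| ->].
        * assert (Hk' : k + 1 <= m) by (apply lt_succ_le, Hk).
          assert (Hkm : k <= m) by (apply Hk).
          rewrite Hsmall by eauto using le_trans.
          rewrite (IH1 k Hk L HL U HU HT Y HY V HV).
          split; intros (A & HA & B & HB & O & HO & HO' & R1 & HAB & R2);
            exists A; (split; [exact HA|]); exists B; (split; [exact HB|]);
            exists O; (split; [exact HO|]); (split; [exact HO'|]);
            (split; [|split; [exact HAB|]]); apply Hsmall; eauto using le_trans.
        * rewrite HZ' by eauto using le_trans.
          split.
          -- intros [[HU' _]|(L' & HL' & HT' & A & HA & B & HB & O & HO & HO' & R1 & HAB & R2)].
             { exfalso; exact (bit_not_len _ _ (top_bit _ _ _ HT) HU'). }
             rewrite (top_inj _ _ _ _ HT' HT) in R2.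
             exists A; (split; [exact HA|]); exists B; (split; [exact HB|]);
             exists O; (split; [exact HO|]); (split; [exact HO'|]);
            (split; [|split; [exact HAB|]]); apply Hsmall; assumption.
          -- intros (A & HA & B & HB & O & HO & HO' & R1 & HAB & R2).
             right; exists L; repeat (split; [assumption|]).
             exists A; (split; [exact HA|]); exists B; (split; [exact HB|]);
             exists O; (split; [exact HO|]); (split; [exact HO'|]);
            (split; [|split; [exact HAB|]]); apply Hsmall; assumption. }
  destruct (H n) as [Z HZ]; exists (rel N Z); split; [unfold rel, code; def_tac | auto].
Qed.

Definition maps (x : num M) (F : str M -> str M -> Prop) : Prop :=
  (forall A, |A| <= x -> exists B, |B| <= x /\ F A B)
  /\ forall A B B', |A| <= x -> |B| <= x -> |B'| <= x -> F A B -> F A B' -> B = B'.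

Section Iteration.

Variables (x n : num M) (F : str M -> str M -> Prop) (r : str M -> str M -> str M -> Prop).
Hypothesis Hr : Def [S2; S2; S2] (fun v => r (snd (fst (fst v))) (snd (fst v)) (snd v)).
Hypothesis HF : maps x F.
Hypothesis HI : Iter x n F r.

Lemma iter_0 U Y V : |U| <= 0 -> |Y| <= x -> |V| <= x -> (r Y U V <-> Y = V).
Proof. intros; apply HI; assumption. Qed.

Lemma iter_top k L U Y V : k < n -> top k L U -> |Y| <= x -> |V| <= x ->
  (r Y U V <->
   exists A, |A| <= x /\ exists B, |B| <= x /\ exists O,
     ones k O /\ r Y O A /\ F A B /\ r B L V).
Proof.
  intros Hk HT HY HV.
  rewrite (proj2 HI k Hk L (proj1 HT) U (top_len _ _ _ HT) HT Y HY V HV).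
  split; intros (A & HA & B & HB & O & H); exists A; (split; [exact HA|]);
    exists B; (split; [exact HB|]); exists O; [apply H|].
  split; [apply ones_len, H | exact H].
Qed.

Lemma iter_total U Y : |U| <= n -> |Y| <= x -> exists V, |V| <= x /\ r Y U V.
Proof.
  intros HU HY; revert U HU Y HY.
  (* The starting point is quantified inside the induction, because the second half of a run starts
     at [B] instead of [Y]. *)
  enough (H : forall k, k <= n -> forall U, |U| <= k -> forall Y, |Y| <= x ->
            exists V, |V| <= x /\ r Y U V) by (apply (H n), le_refl).
  intros k; ind k.
  - intros _ U HU Y HY; exists Y; split; [exact HY | apply iter_0; auto].
  - intros Hk U HU Y HY.
    assert (Hk' : k < n) by (apply lt_le_trans with (k + 1); [apply lt_succ_diag | exact Hk]).
    destruct (len_succ_cases k U HU) as [HU'|[L HT]]; [apply IH; auto; apply Hk'|].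
    destruct (ones_ex k) as [O HO].
    destruct (IH (proj1 Hk') O (ones_len _ _ HO) Y HY) as (A & HA & R1).
    destruct (proj1 HF A HA) as (B & HB & HAB).
    destruct (IH (proj1 Hk') L (proj1 HT) B HB) as (V & HV & R2).
    exists V; split; [exact HV|]; apply (iter_top k L); try assumption.
    exists A; (split; [exact HA|]); exists B; (split; [exact HB|]); exists O; auto.
Qed.

Lemma iter_fun U Y V V' : |U| <= n -> |Y| <= x -> |V| <= x -> |V'| <= x ->
  r Y U V -> r Y U V' -> V = V'.
Proof.
  intros HU HY HV HV'; revert U HU Y HY V HV V' HV'.
  enough (H : forall k, k <= n -> forall U, |U| <= k -> forall Y, |Y| <= x ->
            forall V, |V| <= x -> forall V', |V'| <= x -> r Y U V -> r Y U V' -> V = V')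
    by (apply (H n), le_refl).
  intros k; ind k.
  - intros _ U HU Y HY V HV V' HV' H H'; rewrite iter_0 in H, H' by assumption; congruence.
  - intros Hk U HU Y HY V HV V' HV' H H'.
    assert (Hk' : k < n) by (apply lt_le_trans with (k + 1); [apply lt_succ_diag | exact Hk]).
    destruct (len_succ_cases k U HU) as [HU'|[L HT]];
      [apply (IH (proj1 Hk') U HU' Y); assumption|].
    rewrite (iter_top k L) in H, H' by assumption.
    destruct H as (A & HA & B & HB & O & HO & R1 & HAB & R2).
    destruct H' as (A' & HA' & B' & HB' & O' & HO' & R1' & HAB' & R2').
    rewrite (ones_eq _ _ _ HO' HO) in R1'.
    assert (EA : A' = A) by (apply (IH (proj1 Hk') O (ones_len _ _ HO) Y); assumption).
    rewrite EA in HAB'.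
    assert (EB : B' = B) by (apply (proj2 HF A); assumption).
    rewrite EB in R2'.
    apply (IH (proj1 Hk') L (proj1 HT) B); assumption.
Qed.

End Iteration.

(** * Single steps of the iteration *)

Section IterSucc.

Variables (x n : num M) (F : str M -> str M -> Prop) (r : str M -> str M -> str M -> Prop).
Hypothesis HFd : Def [S2; S2] (fun v => F (snd (fst v)) (snd v)).
Hypothesis Hr : Def [S2; S2; S2] (fun v => r (snd (fst (fst v))) (snd (fst v)) (snd v)).
Hypothesis HI : Iter x n F r.

(** The doubling equation contains one single step explicitly, the one from 2^k - 1 to 2^k. Every
    other step stays within one half and is inherited from shorter exponents. *)
Lemma iter_succ U U' Y V V' : |U| <= n -> |U'| <= n -> |Y| <= x -> |V| <= x -> |V'| <= x ->
  succ U U' -> r Y U V -> F V V' -> r Y U' V'.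
Proof.
  intros HU HU' HY HV HV' HS; revert U HU U' HU' HS Y HY V HV V' HV'.
  enough (H : forall k, k <= n -> forall U, |U| <= k -> forall U', |U'| <= k -> succ U U' ->
     forall Y, |Y| <= x -> forall V, |V| <= x -> forall V', |V'| <= x ->
     r Y U V -> F V V' -> r Y U' V') by (apply (H n), le_refl).
  num_induction; [def_tac | | intros k IH].
  - intros _ U HU U' HU' HS; exfalso; rewrite len_0 in HU, HU'.
    apply (HU' 0), HS; right; split; [apply HU | intros j Hj; exfalso; apply (nlt_0_r j Hj)].
  - intros Hkn U HU U' HU' HS Y HY V HV V' HV' HR HVV.
    assert (Hk' : k < n) by (apply lt_le_trans with (k + 1); [apply lt_succ_diag | exact Hkn]).
    specialize (IH (proj1 Hk')).
    destruct (len_succ_cases k U HU) as [Hsm|[L HT]].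
    + pose proof Hsm as Hsm'; rewrite len_le in Hsm'.
      assert (HUk : ~ bit U k) by (intros H; apply (lt_irrefl k), Hsm', H).
      destruct (classic (exists j, j < k /\ ~ bit U j)) as [(j & Hj & Hb)|Hall].
      * apply (IH U Hsm U') with V; try assumption.
        apply len_le; intros d Hd.
        assert (Hd' : d < k + 1) by (rewrite len_le in HU'; auto).
        apply lt_succ_cases in Hd'; destruct Hd' as [?| ->]; [assumption | exfalso].
        apply HS in Hd; destruct Hd as [[? _]|[_ Hd]]; [contradiction | apply Hb, Hd, Hj].
      (* Here [U] is 2^k - 1 and [U'] is 2^k, that is, top bit [k] over the empty low part [E]; the
         doubling equation for [U'] is then exactly the claim. *)
      * assert (HO : ones k U).
        { intros d; split; [apply Hsm'|]; intros Hd; apply NNPP; intros Hb; apply Hall.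
          exists d; auto. }
        destruct empty_ex as [E HE].
        assert (HE' : |E| <= k) by (apply le_trans with 0; [exact HE | apply le_0_l]).
        apply (iter_top _ _ _ _ HI k E); try assumption.
        { split; [exact HE'|]; rewrite len_0 in HE; intros d; split.
          - intros Hd; right.
            assert (Hd' : d < k + 1) by (rewrite len_le in HU'; auto).
            apply lt_succ_cases in Hd'; destruct Hd' as [Hd'|?]; [exfalso | assumption].
            apply HS in Hd; destruct Hd as [(_ & j & Hj & Hb)|[Hb _]].
            + apply Hb, HO, lt_trans with d; assumption.
            + apply Hb, HO, Hd'.
          - intros [Hd| ->]; [exfalso; apply (HE d Hd)|].
            apply HS; right; split; [exact HUk | intros j; apply HO]. }
        exists V; split; [exact HV|]; exists V'; split; [exact HV'|]; exists U.
        repeat (split; [assumption|]).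
        apply (iter_0 _ _ _ _ HI); auto.
    (* Now [U] is 2^k + L. If some bit below [k] is missing, the carry stops there: [U'] keeps the
       top bit, the low parts are again successors, and induction applies to the run started at
       [B]. *)
    + destruct (classic (exists j, j < k /\ ~ bit U j)) as [(j & Hj & Hb)|Hall].
      * assert (HUk' : bit U' k).
        { apply HS; left; split; [apply (top_bit _ _ _ HT) | exists j; auto]. }
        destruct (low_ex k U') as (L' & HL' & HB).
        assert (HT' : top k L' U').
        { split; [exact HL'|]; intros d; rewrite HB; split.
          - intros Hd; assert (Hd' : d < k + 1) by (rewrite len_le in HU'; auto).
            apply lt_succ_cases in Hd'; tauto.
          - intros [[Hd _]| ->]; assumption. }
        assert (HLU : forall d, d < k -> (bit L d <-> bit U d)).
        { intros d Hd; rewrite (proj2 HT d); pose proof (lt_neq _ _ Hd); tauto. }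
        assert (HSL : succ L L').
        { intros i; rewrite HB; destruct (le_or_lt k i) as [Hi|Hi].
          - assert (HLi : ~ bit L i).
            { intros H; destruct HT as [HL _]; rewrite len_le in HL.
              apply (le_not_lt _ _ Hi), HL, H. }
            split; [intros [_ H]; exfalso; apply (le_not_lt _ _ Hi H)|].
            intros [[H _]|[_ H]]; [contradiction|].
            exfalso; apply Hb, HLU, H; [exact Hj | apply lt_le_trans with k; assumption].
          - rewrite (HLU i Hi), (HS i).
            assert (E1 : (exists j, j < i /\ ~ bit L j) <-> (exists j, j < i /\ ~ bit U j)).
            { split; intros (q & Hq & Hq'); exists q; (split; [exact Hq|]);
                intros HH; apply Hq', HLU; try assumption; apply lt_trans with i; assumption. }
            assert (E2 : (forall j, j < i -> bit L j) <-> (forall j, j < i -> bit U j)).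
            { split; intros HH q Hq; apply HLU; auto; apply lt_trans with i; assumption. }
            tauto. }
        rewrite (iter_top _ _ _ _ HI k L) in HR by assumption.
        destruct HR as (A & HA & B & HB' & O & HO & R1 & HAB & R2).
        apply (iter_top _ _ _ _ HI k L'); try assumption.
        exists A; split; [exact HA|]; exists B; split; [exact HB'|]; exists O.
        repeat (split; [assumption|]).
        apply (IH L (proj1 HT) L' HL' HSL B HB' V HV); assumption.
      (* Otherwise [U] is 2^(k+1) - 1, and its successor is too long. *)
      * exfalso; apply (bit_not_len U' (k + 1)); [|exact HU'].
        apply HS; right; split.
        -- intros H; apply (bit_not_len _ _ H), HU.
        -- intros j Hj; apply NNPP; intros Hb; apply lt_succ_cases in Hj.
           destruct Hj as [Hj| ->]; [apply Hall; exists j; auto | apply Hb, (top_bit _ _ _ HT)].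
Qed.

End IterSucc.

(** * The pigeonhole principle *)

(** Below [k] the bits come from [U], from [k] on from [p]. As [U] runs through the strings of
    length at most [k], [U'] runs through a block of 2^k consecutive strings. *)
Definition splice (x k : num M) (p U U' : str M) : Prop :=
  forall d, d < x -> (bit U' d <-> (d < k /\ bit U d) \/ (k <= d /\ bit p d)).

(** If [H] and [b] mapped the strings of length at most [x] onto pairs of such a string
    and a bit, then every sequence of [2^x] bits would be of the form
    [b (H^U V)], [U < 2^x], for some [V]; the sequence [~ b (H^U U)] is not. *)
Lemma no_surjection x (H : str M -> str M -> Prop) (b : str M -> Prop) :
  Def [S2; S2] (fun v => H (snd (fst v)) (snd v)) -> Def [S2] (fun v => b (snd v)) ->
  maps x H ->
  ~ (forall (c : Prop) V', |V'| <= x -> exists V, |V| <= x /\ H V V' /\ (b V <-> c)).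
Proof.
  intros HHd Hb HH Hsurj.
  destruct (iter_ex x x H HHd) as (Q & HQ & HI).
  (* The diagonal predicate negates the bit that the run from [U] shows at time [U]. It is kept
     abstract so that later definability goals see only that it is definable. *)
  assert (HT : exists T : str M -> Prop, Def [S2] (fun v => T (snd v)) /\
            forall U, T U <-> ~ exists A, |A| <= x /\ Q U U A /\ b A).
  { exists (fun U => ~ exists A, |A| <= x /\ Q U U A /\ b A).
    split; [def_tac | reflexivity]. }
  destruct HT as (T & HTd & HT).
  (* Reading off the block is not enough for the induction: the run must also arrive at a prescribed
     [V'] after 2^k steps, written as 2^k - 1 steps and one more. This is what allows two blocks to
     be joined. *)
  assert (HS : forall k, k <= x -> forall p, |p| <= x -> forall V', |V'| <= x ->
    exists V, |V| <= x /\
      (forall U, |U| <= k -> forall U', |U'| <= x -> splice x k p U U' ->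
         forall A, |A| <= x -> Q V U A -> (b A <-> T U')) /\
      exists A, |A| <= x /\ exists O, |O| <= k /\ ones k O /\ Q V O A /\ H A V').
  { num_induction; [unfold splice; def_tac | | intros k IH].
    - intros _ p Hp V' HV'; destruct (Hsurj (T p) V' HV') as (V & HV & HVV & HbV).
      exists V; split; [exact HV|]; split.
      + intros U HU U' HU' HSp A HA HQA.
        replace U' with p.
        * apply (iter_0 _ _ _ _ HI) in HQA; try assumption; subst; exact HbV.
        * apply bits_eq with x; try assumption; intros d Hd; rewrite (HSp d Hd).
          pose proof (nlt_0_r d); pose proof (le_0_l d); tauto.
      + exists V; split; [exact HV|]; destruct (ones_ex 0) as [O HO].
        pose proof (ones_len _ _ HO).
        exists O; repeat (split; [assumption|]); split; [|exact HVV].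
        apply (iter_0 _ _ _ _ HI); auto.
    - intros Hkx p Hp V' HV'.
      assert (Hk : k < x) by (apply lt_le_trans with (k + 1); [apply lt_succ_diag | exact Hkx]).
      specialize (IH (proj1 Hk)).
      (* The prefixes [p1] and [p0] select the upper and the lower half of the block. The upper half
         is realized first, from some [V1], and the lower half is then directed to arrive at
         [V1]. *)
      destruct (str_ex (fun d => bit p d \/ d = k) x) as [p1 Hp1].
      { def_tac. }
      { rewrite len_le in Hp; intros d [Hd| ->]; auto. }
      destruct (str_ex (fun d => bit p d /\ d <> k) x) as [p0 Hp0].
      { def_tac. }
      { rewrite len_le in Hp; intros d [Hd _]; auto. }
      assert (Hl1 : |p1| <= x).
      { apply len_le; rewrite len_le in Hp; intros d Hd; apply Hp1 in Hd.
        destruct Hd as [Hd| ->]; auto. }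
      assert (Hl0 : |p0| <= x).
      { apply len_le; rewrite len_le in Hp; intros d Hd; apply Hp0 in Hd; apply Hp, Hd. }
      destruct (IH p1 Hl1 V' HV') as (V1 & HV1 & IH1 & A1 & HA1 & O1 & HO1 & HO1' & R1 & E1).
      destruct (IH p0 Hl0 V1 HV1) as (V & HV & IH0 & A0 & HA0 & O & HO & HO' & R0 & E0).
      (* The three positions of [d] relative to [k], spelled out propositionally so that [tauto] can
         compare the splices. *)
      assert (Htri : forall d, (d < k /\ d < k + 1 /\ ~ k <= d /\ ~ k + 1 <= d /\ d <> k)
        \/ (d = k /\ d < k + 1 /\ ~ d < k /\ k <= d /\ ~ k + 1 <= d)
        \/ (~ d < k /\ ~ d < k + 1 /\ k <= d /\ k + 1 <= d /\ d <> k)).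
      { intros d; destruct (le_or_lt (k + 1) d) as [Hd|Hd].
        - right; right; assert (Hd' : k < d) by
            (apply lt_le_trans with (k + 1); [apply lt_succ_diag | exact Hd]).
          repeat split; try apply le_not_lt; try apply Hd'; try exact Hd.
          intros ->; apply (lt_irrefl _ Hd').
        - assert (Hd' : ~ k + 1 <= d) by (intros Hd'; apply (le_not_lt _ _ Hd' Hd)).
          pose proof Hd as Hd2; apply lt_succ_cases in Hd2; destruct Hd2 as [Hd2| ->].
          + left; repeat split; try assumption; try apply Hd2.
            * apply Hd.
            * apply Hd.
            * intros Hd3; apply (le_not_lt _ _ Hd3 Hd2).
          + right; left; repeat split; try assumption; try apply Hd;
              auto using lt_irrefl, le_refl. }
      exists V; split; [exact HV|]; split.
      + intros U HU U' HU' HSp A HA HQA.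
        destruct (len_succ_cases k U HU) as [HU0|[L HL]].
        * apply (IH0 U HU0 U' HU'); try assumption.
          intros d Hd; rewrite (HSp d Hd), (Hp0 d).
          rewrite len_le in HU0; specialize (HU0 d).
          destruct (Htri d) as [Hd'|[Hd'|Hd']]; tauto.
        * apply (iter_top _ _ _ _ HI k L) in HQA; try assumption.
          destruct HQA as (A2 & HA2 & B & HB & O2 & HO2 & R2 & E2 & R3).
          rewrite (ones_eq _ _ _ HO2 HO') in R2.
          assert (EA : A2 = A0).
          { apply (iter_fun _ _ _ _ HQ HH HI O V); try assumption.
            apply le_trans with k; [exact HO | apply Hk]. }
          rewrite EA in E2.
          assert (EB : B = V1) by (apply (proj2 HH A0); assumption).
          rewrite EB in R3.
          apply (IH1 L (proj1 HL) U' HU'); try assumption.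
          intros d Hd; rewrite (HSp d Hd), (Hp1 d), (proj2 HL d).
          destruct (Htri d) as [Hd'|[Hd'|Hd']]; tauto.
      + exists A1; split; [exact HA1|]; destruct (ones_ex (k + 1)) as [O' HO''].
        exists O'; split; [apply ones_len, HO''|]; split; [exact HO''|]; split; [|exact E1].
        apply (iter_top _ _ _ _ HI k O1); try assumption.
        { apply ones_succ; assumption. }
        exists A0; split; [exact HA0|]; exists V1; split; [exact HV1|]; exists O; auto. }
  (* For [k = x] the block consists of all strings of length at most [x], and [E] is an arbitrary
     choice of prefix and target. At time [V] the run from [V] would show the negation of its own
     bit. *)
  destruct empty_ex as [E HE].
  assert (HEx : |E| <= x) by (apply le_trans with 0; [exact HE | apply le_0_l]).
  destruct (HS x (le_refl x) E HEx E HEx) as (V & HV & HD & _).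
  destruct (iter_total _ _ _ _ HQ HH HI V V HV HV) as (A & HA & HQA).
  assert (HbT : b A <-> T V).
  { apply (HD V HV V HV); try assumption.
    intros d Hd; pose proof (le_not_lt x d); tauto. }
  rewrite HT in HbT.
  assert (HbA : b A <-> exists A, |A| <= x /\ Q V V A /\ b A).
  { split; [intros Hb'; exists A; auto|].
    intros (A' & HA' & HQA' & Hb').
    rewrite (iter_fun _ _ _ _ HQ HH HI V V A A'); assumption. }
  tauto.
Qed.

Lemma pigeonhole x (G : str M -> str M -> Prop) :
  Def [S2; S2] (fun v => G (snd (fst v)) (snd v)) ->
  (forall U, |U| <= x + 1 -> exists V, |V| <= x /\ G U V) ->
  exists U, |U| <= x + 1 /\ exists U', |U'| <= x + 1 /\ U <> U' /\
    exists V, |V| <= x /\ G U V /\ G U' V.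
Proof.
  intros HG Htot; apply NNPP; intros Hno.
  assert (Hinj : forall U U' V, |U| <= x + 1 -> |U'| <= x + 1 -> |V| <= x ->
            G U V -> G U' V -> U = U').
  { intros U U' V HU HU' HV H H'; apply NNPP; intros Hn; apply Hno.
    exists U; split; [exact HU|]; exists U'; repeat (split; [assumption|]); exists V; auto. }
  (* The injection is read backwards: [V] yields the lower [x] bits of its preimage as the next
     string and bit [x] of it as the bit shown. A string outside the range gets the empty string by
     default, so that the map is total. *)
  apply (no_surjection x
    (fun V V' => (exists U, |U| <= x + 1 /\ G U V /\ forall d, d < x -> (bit V' d <-> bit U d))
       \/ ((forall U, |U| <= x + 1 -> ~ G U V) /\ |V'| <= 0))
    (fun V => exists U, |U| <= x + 1 /\ G U V /\ bit U x)).
  - def_tac.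
  - def_tac.
  - split.
    + intros V HV; destruct (classic (exists U, |U| <= x + 1 /\ G U V)) as [(U & HU & HUV)|Hn].
      * destruct (low_ex x U) as (L & HL & HLU); exists L; split; [exact HL|]; left.
        exists U; repeat (split; [assumption|]); intros d Hd; rewrite HLU; tauto.
      * destruct empty_ex as [E HE]; exists E.
        split; [apply le_trans with 0; [exact HE | apply le_0_l]|].
        right; split; [|exact HE]; intros U HU HUV; apply Hn; exists U; auto.
    + intros V B B' HV HB HB' [(U & HU & HUV & H)|[Hn H]] [(U' & HU' & HUV' & H')|[Hn' H']].
      * rewrite (Hinj U U' V) in H by assumption.
        apply bits_eq with x; try assumption; intros d Hd; rewrite (H d Hd), (H' d Hd).
        reflexivity.
      * exfalso; apply (Hn' U); assumption.
      * exfalso; apply (Hn U'); assumption.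
      * apply len_0_eq; assumption.
  - intros c V' HV'.
    (* The preimage wanted is [V'] with [c] placed at position [x]; its image under [G] then hits
       the given pair. *)
    assert (HU : exists U, |U| <= x + 1 /\ (bit U x <-> c)
                           /\ forall d, d < x -> (bit V' d <-> bit U d)).
    { destruct (classic c) as [Hc|Hc].
      - destruct (top_ex x V' HV') as [U HU]; exists U.
        split; [apply (top_len _ _ _ HU)|]; split.
        + pose proof (top_bit _ _ _ HU); tauto.
        + intros d Hd; rewrite (proj2 HU d); pose proof (lt_neq _ _ Hd); tauto.
      - exists V'; split; [apply le_trans with x; [exact HV' | apply le_succ_diag]|].
        split; [|reflexivity].
        split; [|tauto]; intros Hb; exfalso; exact (bit_not_len _ _ Hb HV'). }
    destruct HU as (U & HU & HUc & HUV').
    destruct (Htot U HU) as (V & HV & HUV); exists V; split; [exact HV|]; split.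
    + left; exists U; auto.
    + rewrite <- HUc; split; [|intros Hb; exists U; auto].
      intros (U2 & HU2 & HUV2 & Hb); rewrite (Hinj U U2 V); assumption.
Qed.

(** * Subtraction *)

(** With [G] the generated and [P] the propagated carries: a carry enters position [i]. *)
Definition chain_at (G P : num M -> Prop) (i : num M) : Prop :=
  exists k, k < i /\ G k /\ forall j, j < i -> k < j -> P j.

Lemma chain_at_0 G P : ~ chain_at G P 0.
Proof. intros (k & Hk & _); apply (nlt_0_r k Hk). Qed.

(** The ripple recurrence hidden in the look-ahead form: a carry is generated at [i], or an earlier
    one is propagated. It opens carries to induction on the position. *)
Lemma chain_at_succ G P i :
  chain_at G P (i + 1) <-> G i \/ (P i /\ chain_at G P i).
Proof.
  split.
  - intros (k & Hk & HG & HP); apply lt_succ_cases in Hk; destruct Hk as [Hk| ->]; [right | auto].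
    split; [apply HP; [apply lt_succ_diag | exact Hk]|].
    exists k; repeat split; try apply Hk; try exact HG.
    intros j Hj; apply HP, lt_trans with i; [exact Hj | apply lt_succ_diag].
  - intros [HG|(HP & k & Hk & HG & H)].
    + exists i; repeat split; try apply lt_succ_diag; try exact HG.
      intros j Hj Hij; exfalso; apply lt_succ_r in Hj; exact (le_not_lt _ _ Hj Hij).
    + exists k; split; [apply lt_trans with i; [exact Hk | apply lt_succ_diag]|].
      split; [exact HG|]; intros j Hj; apply lt_succ_cases in Hj.
      destruct Hj as [Hj| ->]; [apply H, Hj | auto].
Qed.

Definition xor (A B : Prop) : Prop := (A /\ ~ B) \/ (~ A /\ B).

Definition carry_in (X Y : str M) : num M -> Prop :=
  chain_at (fun k => bit X k /\ bit Y k) (fun j => bit X j \/ bit Y j).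

Definition borrow_in (W X : str M) : num M -> Prop :=
  chain_at (fun k => ~ bit W k /\ bit X k) (fun j => ~ bit W j \/ bit X j).

Definition sum (W X Y : str M) : Prop :=
  |W| <= |X| + |Y|
  /\ forall d, d < |X| + |Y| -> (bit W d <-> xor (xor (bit X d) (bit Y d)) (carry_in X Y d)).

(** The hypotheses make [k] the highest position of difference, so [W] is the larger number. The
    witness is the bitwise exclusive or of [W], [X] and the borrows. *)
Lemma subtraction m W X k :
  |W| <= m -> |X| <= m -> bit W k -> ~ bit X k ->
  (forall j, k < j -> (bit X j <-> bit W j)) ->
  exists V, |V| <= m /\ ~ |V| <= 0 /\ sum W X V.
Proof.
  intros HW HX HWk HXk Heq.
  destruct (comprehension_str (fun d => xor (xor (bit W d) (bit X d)) (borrow_in W X d)) m)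
    as (V & HV & HVb); [unfold xor, borrow_in, chain_at; def_tac|].
  (* The carries of [X + V] are the borrows of [W - X]; the exclusive ors then cancel and leave the
     bits of [W]. *)
  assert (HcX : forall i, i <= m -> (carry_in X V i <-> borrow_in W X i)).
  { intros i; ind i.
    - intros _; split; intros H; exfalso; exact (chain_at_0 _ _ H).
    - intros Hi; assert (Hi' : i < m) by
        (apply lt_le_trans with (i + 1); [apply lt_succ_diag | exact Hi]).
      unfold carry_in, borrow_in; rewrite !chain_at_succ.
      fold (carry_in X V i) (borrow_in W X i); rewrite (IH (proj1 Hi')), (HVb i Hi').
      unfold xor; clear.
      destruct (classic (bit W i)), (classic (bit X i)), (classic (borrow_in W X i)); tauto. }
  pose proof HW as HWl; pose proof HX as HXl; pose proof HV as HVl.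
  rewrite len_le in HWl, HXl, HVl.
  (* No borrow leaves the top: it would have to be generated above [k], where the strings agree, or
     to pass [k], which stops it. *)
  assert (Hbm : ~ borrow_in W X m).
  { intros (q & Hq & [HWq HXq] & HP).
    destruct (le_or_lt q k) as [Hqk|Hqk].
    - destruct (classic (q = k)) as [->|Hn]; [contradiction|].
      destruct (HP k (HWl k HWk) (conj Hqk Hn)); contradiction.
    - apply HWq, Heq; assumption. }
  assert (Hcm : forall i, m <= i -> ~ carry_in X V i).
  { intros i Hi Hc; destruct (classic (m = i)) as [<-|Hn].
    - apply Hbm, HcX; [apply le_refl | exact Hc].
    - destruct Hc as (q & Hq & [HXq _] & HP).
      destruct (HP m (conj Hi Hn) (HXl q HXq)) as [Hb|Hb];
        [apply HXl in Hb | apply HVl in Hb]; exact (lt_irrefl _ Hb). }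
  exists V; split; [exact HV|]; split.
  - rewrite len_0; intros HV0.
    assert (Hnc : ~ borrow_in W X k).
    { rewrite <- HcX by apply HWl, HWk; intros (q & _ & [_ Hq] & _); exact (HV0 q Hq). }
    apply (HV0 k), HVb; [apply HWl, HWk|]; unfold xor; tauto.
  - split.
    (* A bit of [W] at [d] beyond [|X| + |V|] could only be a carry into [d = e + 1]. Then one
       summand contains [e] and both contain some [q <= e], so the lengths add up to at least
       [e + 2]. *)
    + apply len_le; intros d Hd.
      destruct (le_or_lt (|X| + |V|) d) as [Hle|Hlt]; [exfalso | exact Hlt].
      assert (HXd : ~ bit X d).
      { intros H; apply bit_lt in H; apply (le_not_lt (|X| + |V|) d Hle).
        apply lt_le_trans with (|X|); [exact H | apply le_add_r]. }
      assert (HVd : ~ bit V d).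
      { intros H; apply bit_lt in H; apply (le_not_lt (|X| + |V|) d Hle).
        apply lt_le_trans with (|V|); [exact H | apply le_add_l]. }
      assert (Hc : carry_in X V d).
      { apply HcX; [apply HWl, Hd|]; rewrite (HVb d (HWl d Hd)) in HVd.
        apply NNPP; unfold xor in HVd; tauto. }
      destruct Hc as (q & Hq & [HXq HVq] & HP).
      destruct (pred_ex d) as [e He]; [intros ->; exact (nlt_0_r _ Hq)|]; subst d.
      assert (Hbig : forall a b, e < a -> q < b -> ~ a + b <= e + 1).
      { intros a b Ha Hb Hab; apply lt_iff in Ha, Hb; destruct Ha as [c ->], Hb as [c' ->].
        apply (le_not_lt _ _ Hab), lt_iff; exists (c + (q + c')); ring. }
      assert (He : bit X e \/ bit V e).
      { apply lt_succ_cases in Hq; destruct Hq as [Hq| ->]; [|left; exact HXq].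
        apply HP; [apply lt_succ_diag | exact Hq]. }
      destruct He as [He|He].
      * apply (Hbig (|X|) (|V|)); try apply bit_lt; assumption.
      * apply (Hbig (|V|) (|X|)); try apply bit_lt; try assumption.
        rewrite add_comm; exact Hle.
    + intros d _; destruct (le_or_lt m d) as [Hd|Hd].
      * pose proof (Hcm d Hd).
        assert (~ bit W d) by (intros H'; apply (le_not_lt _ _ Hd), HWl, H').
        assert (~ bit X d) by (intros H'; apply (le_not_lt _ _ Hd), HXl, H').
        assert (~ bit V d) by (intros H'; apply (le_not_lt _ _ Hd), HVl, H').
        unfold xor; tauto.
      * unfold xor; rewrite (HVb d Hd), (HcX d (proj1 Hd)); unfold xor.
        destruct (classic (bit W d)), (classic (bit X d)), (classic (borrow_in W X d)); tauto.
Qed.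

Lemma last_difference U U' b :
  (exists d, d < b /\ ~ (bit U d <-> bit U' d)) ->
  exists k, k < b /\ ~ (bit U k <-> bit U' k)
            /\ forall j, j < b -> k < j -> (bit U j <-> bit U' j).
Proof.
  ind b.
  - intros (d & Hd & _); exfalso; exact (nlt_0_r d Hd).
  - intros (d & Hd & Hdd).
    destruct (classic (bit U b <-> bit U' b)) as [Hb|Hb].
    + destruct IH as (k & Hk & Hkk & H).
      { exists d; split; [|exact Hdd]; apply lt_succ_cases in Hd.
        destruct Hd as [Hd| ->]; tauto. }
      exists k; split; [apply lt_trans with b; [exact Hk | apply lt_succ_diag]|].
      split; [exact Hkk|]; intros j Hj; apply lt_succ_cases in Hj.
      destruct Hj as [Hj| ->]; auto.
    + exists b; split; [apply lt_succ_diag|]; split; [exact Hb|].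
      intros j Hj Hbj; exfalso; apply lt_succ_r in Hj; exact (le_not_lt _ _ Hj Hbj).
Qed.

Lemma difference m U U' : |U| <= m -> |U'| <= m -> U <> U' ->
  (exists V, |V| <= m /\ ~ |V| <= 0 /\ sum U U' V)
  \/ exists V, |V| <= m /\ ~ |V| <= 0 /\ sum U' U V.
Proof.
  intros HU HU' Hn.
  destruct (last_difference U U' m) as (k & Hk & Hkk & H).
  { apply NNPP; intros H; apply Hn, bits_eq with m; try assumption.
    intros i Hi; apply NNPP; intros Hb; apply H; exists i; auto. }
  assert (Heq : forall j, k < j -> (bit U j <-> bit U' j)).
  { intros j Hj; destruct (le_or_lt m j) as [Hm|Hm]; [|auto].
    rewrite len_le in HU, HU'; split; intros Hb; exfalso; apply (le_not_lt _ _ Hm); auto. }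
  destruct (classic (bit U k)) as [Hb|Hb]; [left | right].
  - apply (subtraction m U U' k); try assumption; [tauto|].
    intros j Hj; rewrite (Heq j Hj); reflexivity.
  - apply (subtraction m U' U k); try assumption; tauto.
Qed.

(** * Pairs of strings *)

Definition np (a b : num M) : num M := (a + b) * (a + b + 1) + (1 + 1) * b.

(** With s = a + b and b at most s, s(s + 1) + 2b stays below (s + 1)(s + 2). Injectivity follows by
    comparing sums first. *)
Lemma np_lt a b a' b' : a + b < a' + b' -> np a b < np a' b'.
Proof.
  rewrite !lt_iff; intros [c Hc]; unfold np; rewrite Hc.
  exists (1 + (1 + 1) * a + (1 + 1) * ((a + b) * c) + (1 + 1 + 1) * c + c * c + (1 + 1) * b').
  ring.
Qed.

Lemma np_inj a b a' b' : np a b = np a' b' -> a = a' /\ b = b'.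
Proof.
  intros H.
  assert (Hs : a + b = a' + b').
  { destruct (le_or_lt (a + b) (a' + b')) as [Hle|Hlt].
    - apply NNPP; intros Hn; apply (lt_neq _ _ (np_lt _ _ _ _ (conj Hle Hn)) H).
    - exfalso; apply (lt_neq _ _ (np_lt _ _ _ _ Hlt)); auto. }
  unfold np in H; rewrite Hs in H; apply add_cancel_l in H.
  assert (Hdbl : forall q q', q < q' -> (1 + 1) * q <> (1 + 1) * q').
  { intros q q' Hq; apply lt_neq; apply lt_iff in Hq; destruct Hq as [c ->].
    apply lt_iff; exists (1 + (1 + 1) * c); ring. }
  assert (Hb : b = b').
  { destruct (le_or_lt b b') as [Hle|Hlt].
    - apply NNPP; intros Hn; apply (Hdbl _ _ (conj Hle Hn) H).
    - exfalso; apply (Hdbl _ _ Hlt); auto. }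
  subst b'; apply add_cancel_r in Hs; auto.
Qed.

Lemma le_np a b : b <= np a b.
Proof. apply le_iff; exists ((a + b) * (a + b + 1) + b); unfold np; ring. Qed.

Lemma np_mono a b b' : b <= b' -> np a b <= np a b'.
Proof.
  rewrite !le_iff; intros [c ->]; unfold np.
  exists (c * (a + b + c + 1) + (a + b) * c + (1 + 1) * c); ring.
Qed.

Definition pair (W U V : str M) : Prop :=
  |W| <= np 1 (|U| + |V|) /\ forall d, d < np 1 (|U| + |V|) ->
    (bit W d <-> exists j, j <= d /\ ((d = np 0 j /\ bit U j) \/ (d = np 1 j /\ bit V j))).

Lemma pair_ex U V : exists W, pair W U V.
Proof.
  destruct (comprehension_str (fun d =>
    exists j, j <= d /\ ((d = np 0 j /\ bit U j) \/ (d = np 1 j /\ bit V j)))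
    (np 1 (|U| + |V|))) as (W & HW & H); [unfold np; def_tac|].
  exists W; split; assumption.
Qed.

Lemma pair_bits W U V : pair W U V ->
  forall j, (bit W (np 0 j) <-> bit U j) /\ (bit W (np 1 j) <-> bit V j).
Proof.
  intros [HW H] j; rewrite len_le in HW; split; split; intros Hb.
  - apply H in Hb; [|auto]; destruct Hb as (i & _ & [[Hi Hb]|[Hi _]]); apply np_inj in Hi.
    + destruct Hi as [_ ->]; exact Hb.
    + destruct Hi as [Hi _]; exfalso; apply (succ_neq_0 0); rewrite add_0_l; auto.
  - apply H; [|exists j; split; [apply le_np | auto]].
    apply np_lt; rewrite add_0_l; apply lt_le_trans with (|U|); [apply bit_lt, Hb|].
    apply le_trans with (|U| + |V|); [apply le_add_r | apply le_add_l].
  - apply H in Hb; [|auto]; destruct Hb as (i & _ & [[Hi _]|[Hi Hb]]); apply np_inj in Hi.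
    + destruct Hi as [Hi _]; exfalso; apply (succ_neq_0 0); rewrite add_0_l; auto.
    + destruct Hi as [_ ->]; exact Hb.
  - apply H; [|exists j; split; [apply le_np | auto]].
    apply np_lt, add_lt_mono_l, lt_le_trans with (|V|); [apply bit_lt, Hb | apply le_add_l].
Qed.

Lemma pair_inj W U V U' V' : pair W U V -> pair W U' V' -> U = U' /\ V = V'.
Proof.
  intros H H'; split; apply str_ext; intros d;
    destruct (pair_bits _ _ _ H d) as [E1 E2], (pair_bits _ _ _ H' d) as [E1' E2'].
  - rewrite <- E1; exact E1'.
  - rewrite <- E2; exact E2'.
Qed.

(** * The axiom scheme *)

(** Inside [Pdef] the formula [phi] is evaluated under a quantified hyper string, which shifts the
    environment of that sort. *)
Lemma sat_SigmaB0_hyp A : SigmaB0 A -> forall e1 e2 e3 e3',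
  @sat M e1 e2 e3 A <-> sat e1 e2 e3' A.
Proof.
  induction 1; intros e1 e2 e3 e3'; cbn [sat]; try reflexivity;
    try (rewrite (IHSigmaB0_1 _ _ e3 e3'), (IHSigmaB0_2 _ _ e3 e3'); reflexivity).
  - split; intros Hs d Hd; apply (IHSigmaB0 _ _ e3 e3'), Hs, Hd.
  - split; intros (d & Hd & Hs); exists d; (split; [exact Hd|]); apply (IHSigmaB0 _ _ e3 e3'), Hs.
Qed.

Lemma sat_is_pair e1 e2 e3 W X Y :
  @sat M e1 e2 e3 (is_pair W X Y) <-> pair (e2 W) (e2 X) (e2 Y).
Proof.
  split; intros [HW Hs]; (split; [exact HW|]).
  - intros d Hd; exact (Hs d (proj1 Hd) Hd).
  - intros d _ Hd; exact (Hs d Hd).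
Qed.

Definition value (x : num M) (Z : hyp M) (U V : str M) : Prop :=
  |V| <= x /\ exists W, pair W U V /\ mem Z W.

Lemma sat_hval e1 e2 e3 t Z U V :
  @sat M e1 e2 e3 (hval t Z U V) <-> value (eval e1 e2 t) (e3 Z) (e2 U) (e2 V).
Proof.
  unfold hval, value; cbn [sat].
  split; intros [HV (W & HW & Hm)]; (split; [exact HV|]); exists W; (split; [|exact Hm]);
    apply sat_is_pair in HW || apply sat_is_pair; exact HW.
Qed.

Lemma succ_ex e1 e2 e3 U X : e2 X = U ->
  exists S, |S| <= |U| + 1 /\ succ U S /\ @sat M e1 (scons S e2) e3 (is_succ 0 (1 + X)).
Proof.
  intros HX; destruct (comprehension_str (fun i =>
    (bit U i /\ exists j, j < i /\ ~ bit U j) \/ (~ bit U i /\ forall j, j < i -> bit U j))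
    (|U| + 1)) as (S & HS & H); [def_tac|].
  exists S; split; [exact HS|]; split.
  - intros i; destruct (le_or_lt (|U| + 1) i) as [Hi|Hi]; [|apply H, Hi].
    rewrite len_le in HS; split; intros Hb.
    + exfalso; apply (le_not_lt _ _ Hi), HS, Hb.
    + exfalso; destruct Hb as [[Hb _]|[_ Hb]].
      * apply bit_lt in Hb; apply (le_not_lt _ _ Hi), lt_succ_r, Hb.
      * apply (lt_irrefl (|U|)), bit_lt, Hb.
        apply lt_le_trans with (2 := Hi), lt_succ_diag.
  - split; cbn; rewrite HX; [exact HS|]; intros i _ Hi; specialize (H i Hi).
    assert (E1 : (exists j, j <= i /\ (j <= i /\ (j = i -> False)) /\ (bit U j -> False))
                 <-> exists j, j < i /\ ~ bit U j).
    { split; [intros (j & _ & Hj); exists j; exact Hj|].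
      intros (j & Hj & Hb); exists j; repeat split; try apply Hj; exact Hb. }
    assert (E2 : (forall j, j <= i -> j <= i /\ (j = i -> False) -> bit U j)
                 <-> forall j, j < i -> bit U j).
    { split; [intros Hb j Hj; apply Hb; [apply Hj | exact Hj]|].
      intros Hb j _ Hj; apply Hb, Hj. }
    rewrite E1, E2; fold (~ bit U i); tauto.
Qed.

Lemma sat_is_add e1 e2 e3 W X Y :
  sum (e2 W) (e2 X) (e2 Y) -> @sat M e1 e2 e3 (is_add W X Y).
Proof.
  intros [HW Hs]; split; [exact HW|]; intros d _ Hd; specialize (Hs d Hd); cbn in *.
  assert (E : carry_in (e2 X) (e2 Y) d <->
    exists k, k <= d /\ (k <= d /\ (k = d -> False)) /\ (bit (e2 X) k /\ bit (e2 Y) k /\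
      forall j, j <= d -> j <= d /\ (j = d -> False) -> k <= j /\ (k = j -> False) ->
        bit (e2 X) j \/ bit (e2 Y) j)).
  { split.
    - intros (k & Hk & [HX HY] & H); exists k; repeat split; try apply Hk; try assumption.
      intros j _; apply H.
    - intros (k & _ & Hk & HX & HY & H); exists k; split; [exact Hk|].
      split; [split; assumption|]; intros j Hj; apply H; [apply Hj | exact Hj]. }
  unfold xor in Hs; rewrite E in Hs; exact Hs.
Qed.

Section Pdef.

Variables (phi : fm) (e1 : nat -> num M) (e2 : nat -> str M) (e3 : nat -> hyp M).
Hypothesis Hphi : SigmaB0 phi.

Let x := e1 0%nat.

Definition step (V V' : str M) : Prop :=
  forall i, i < x -> (bit V' i <->
    sat (scons i (fun n => e1 (S n))) (scons V (fun m => e2 (3 + m)%nat)) e3 phi).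

Variables (n : num M) (Z : hyp M) (E : str M) (r : str M -> str M -> Prop).
Hypothesis HZ : forall U V, |U| <= n -> (value x Z U V <-> |V| <= x /\ r U V).
Hypothesis Htot : forall U, |U| <= n -> exists V, |V| <= x /\ r U V.
Hypothesis Hfun : forall U V V', |U| <= n -> |V| <= x -> |V'| <= x ->
  r U V -> r U V' -> V = V'.
Hypothesis Hsucc : forall U U' V V', |U| <= n -> |U'| <= n -> |V| <= x -> |V'| <= x ->
  succ U U' -> r U V -> r U' V' -> step V V'.
Hypothesis H0 : |E| <= 0.
Hypothesis HrE : forall V, |V| <= 0 -> r E V.

Lemma sat_Pdef : |e2 0%nat| + 1 <= n -> |e2 1%nat| <= 0 -> |e2 2%nat| <= x ->
  r (e2 0%nat) (e2 2%nat) -> sat e1 e2 e3 (Pdef phi).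
Proof.
  intros HX HY HV HXV.
  assert (HXn : |e2 0%nat| <= n) by (eapply le_trans; [apply le_succ_diag | exact HX]).
  exists Z; split; [|split; [|split]].
  - exists E; split.
    + apply le_antisym; [exact H0 | apply le_0_l].
    + apply sat_hval, HZ.
      * eapply le_trans; [exact H0 | apply le_0_l].
      * split; [eapply le_trans; [exact HY | apply le_0_l] | apply HrE, HY].
  - apply sat_hval, HZ; [exact HXn | split; assumption].
  - intros U HU _.
    assert (HUn : |U| <= n) by (eapply le_trans; [exact HU | exact HXn]).
    split.
    + destruct (Htot U HUn) as (V & HVx & HUV); exists V; apply sat_hval, HZ; auto.
    + intros V V' [HV1 HV2]; apply sat_hval, HZ in HV1; [|exact HUn].
      apply sat_hval, HZ in HV2; [|exact HUn].
      apply (Hfun U); tauto.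
  - intros U HU _.
    destruct (succ_ex e1 (scons U e2) (scons Z e3) U 0 eq_refl) as (U' & HU' & HS & HSs).
    (* A string below [X] can be as long as [X], and its successor one position longer; hence [n]
       must exceed the length of [X]. *)
    assert (HUn : |U| + 1 <= n).
    { eapply le_trans; [|exact HX]; rewrite !(add_comm _ 1); apply add_le_mono_l, HU. }
    exists U'; split; [exact HSs|].
    intros V V' [HV1 HV2]; apply sat_hval, HZ in HV1;
      [|eapply le_trans; [apply le_succ_diag | exact HUn]].
    apply sat_hval, HZ in HV2; [|eapply le_trans; [exact HU' | exact HUn]].
    intros i _ Hi.
    assert (Hstep : step V V').
    { apply (Hsucc U U'); try tauto.
      - eapply le_trans; [apply le_succ_diag | exact HUn].
      - eapply le_trans; [exact HU' | exact HUn]. }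
    specialize (Hstep i Hi); cbn [sat FIff]; rewrite !sat_subst.
    match goal with |- context [sat ?f1 ?f2 ?f3 phi] =>
      replace f1 with (scons i (fun n => e1 (S n)));
      [replace f2 with (scons V (fun m => e2 (3 + m)%nat)) |]
    end; [| extensionality k; destruct k; reflexivity ..].
    rewrite (sat_SigmaB0_hyp phi Hphi _ _ e3 (fun k => scons Z e3 (rid k))) in Hstep.
    exact Hstep.
Qed.

End Pdef.

Lemma sat_ID phi e1 e2 e3 : SigmaB0 phi -> @sat M e1 e2 e3 (ID phi).
Proof.
  intros Hphi x.
  (* The colliding exponents have length at most [x + 1]; one more position makes room for
     successors. *)
  pose (n := x + 1 + 1).
  pose (F := fun V V' => forall i, i < x -> (bit V' i <-> sat (scons i e1) (scons V e2) e3 phi)).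
  assert (Hsat : Def [S2; S1] (fun v => sat (scons (snd (fst v)) e1) (scons (snd v) e2) e3 phi))
    by apply (def_sat phi e1 e2 e3 (SigmaB0_SigmaBB0 _ Hphi)).
  assert (HFd : Def [S2; S2] (fun v => F (snd (fst v)) (snd v))).
  { unfold F; apply def_all1_lt; [def_tac|]; apply def_iff; [def_tac|].
    apply (def_app_NS _ (fun i V => sat (scons i e1) (scons V e2) e3 phi) _ _ Hsat); def_tac. }
  assert (HF : maps x F).
  { split.
    - intros V _; apply comprehension_str.
      apply (def_app_NS _ (fun i V => sat (scons i e1) (scons V e2) e3 phi) _ _ Hsat); def_tac.
    - intros V B B' _ HB HB' H H'; apply bits_eq with x; try assumption.
      intros i Hi; rewrite (H i Hi), (H' i Hi); reflexivity. }
  destruct (iter_ex x n F HFd) as (r & Hr & HI).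
  destruct empty_ex as [E HE].
  assert (HEx : |E| <= x) by (eapply le_trans; [exact HE | apply le_0_l]).
  (* The orbit of the empty string is stored again under the pairing that [Pdef] prescribes, and
     serves both colliding exponents. The number [np 1 (n + x)] bounds the length of every pair that
     occurs. *)
  destruct (comprehension_hyp (fun W => exists U, |U| <= n /\ exists V, |V| <= x /\
    pair W U V /\ r E U V) (np 1 (n + x))) as [Z HZ'].
  { unfold pair, np; def_tac. }
  assert (HZ : forall U V, |U| <= n -> (value x Z U V <-> |V| <= x /\ r E U V)).
  { intros U V HU; split.
    - intros [HV (W & HW & Hm)]; split; [exact HV|]; apply HZ' in Hm.
      + destruct Hm as (U' & HU' & V' & HV' & HW' & HR).
        destruct (pair_inj _ _ _ _ _ HW HW') as [-> ->]; exact HR.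
      + eapply le_trans; [apply HW | apply np_mono].
        apply le_trans with (n + |V|); [|apply add_le_mono_l, HV].
        rewrite !(add_comm _ (|V|)); apply add_le_mono_l, HU.
    - intros [HV HR]; split; [exact HV|]; destruct (pair_ex U V) as [W HW].
      exists W; split; [exact HW|]; apply HZ'.
      + eapply le_trans; [apply HW | apply np_mono].
        apply le_trans with (n + |V|); [|apply add_le_mono_l, HV].
        rewrite !(add_comm _ (|V|)); apply add_le_mono_l, HU.
      + exists U; split; [exact HU|]; exists V; auto. }
  assert (Hxn : x + 1 <= n) by apply le_succ_diag.
  destruct (pigeonhole x (fun U V => r E U V)) as (U & HU & U' & HU' & Hne & V & HV & H1 & H2).
  { apply (def_app_SSS _ r _ _ _ Hr); def_tac. }
  { intros U HU; apply (iter_total _ _ _ _ Hr HF HI); [|exact HEx].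
    eapply le_trans; [exact HU | exact Hxn]. }
  assert (HP : forall e2' X, (forall m, e2' (3 + m)%nat = e2 m) -> e2' 0%nat = X ->
            e2' 1%nat = E -> e2' 2%nat = V -> |X| <= x + 1 -> r E X V ->
            sat (scons x e1) e2' e3 (Pdef phi)).
  { intros e2' X Hm <- HY HZV HX HR.
    apply (sat_Pdef phi (scons x e1) e2' e3 Hphi n Z E (r E)); auto.
    - intros Y HY'; apply (iter_total _ _ _ _ Hr HF HI); assumption.
    - intros Y B B' HY' HB HB'; apply (iter_fun _ _ _ _ Hr HF HI); assumption.
    - intros Y Y' B B' HY' HY'' HB HB' HS HB1 HB2.
      (* The iteration is known to take the value of [F] at [B]; uniqueness of values identifies it
         with the given [B']. *)
      destruct (proj1 HF B HB) as (B2 & HB2' & HFB).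
      assert (HRB : r E Y' B2)
        by (apply (iter_succ x n F r HFd Hr HI Y Y' E B B2); assumption).
      assert (EB : B' = B2) by (apply (iter_fun _ _ _ _ Hr HF HI Y' E); assumption).
      subst B2; intros i Hi; rewrite (HFB i Hi).
      replace (fun m => e2' (3 + m)%nat) with e2 by (extensionality m; auto).
      reflexivity.
    - intros B HB; apply (iter_0 _ _ _ _ HI); try assumption.
      + eapply le_trans; [exact HB | apply le_0_l].
      + apply len_0_eq; assumption.
    - rewrite !(add_comm _ 1); unfold n; rewrite (add_comm _ 1); apply add_le_mono_l, HX.
    - rewrite HY; exact HE.
    - rewrite HZV; exact HV.
    - rewrite HZV; exact HR. }
  (* The goal with its substitutions already evaluated. Both orders of the colliding pair reduce to
     it, the larger string being the witness for the sum. *)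
  assert (Hgoal : forall U U', |U| <= x + 1 -> |U'| <= x + 1 -> r E U V -> r E U' V ->
    (exists D, |D| <= x + 1 /\ ~ |D| <= 0 /\ sum U' U D) ->
    exists U, |U| <= x + 1 /\ exists D, |D| <= x + 1 /\ (|D| <> 0 /\
      exists E W V, |E| = 0 /\
        sat (scons x e1) (scons V (scons W (scons E (scons D (scons U e2))))) e3 (is_add 1 4 3)
        /\ sat (scons x e1)
             (fun k => scons V (scons W (scons E (scons D (scons U e2))))
                (scons 1 (scons 2 (scons 0 (fun m => 5 + m))) k)%nat) e3 (Pdef phi)
        /\ sat (scons x e1)
             (fun k => scons V (scons W (scons E (scons D (scons U e2))))
                (scons 4 (scons 2 (scons 0 (fun m => 5 + m))) k)%nat) e3 (Pdef phi))).
  { clear U HU U' HU' Hne H1 H2; intros U U' HU HU' H1 H2 (D & HD & HD0 & HS).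
    exists U; split; [exact HU|]; exists D; split; [exact HD|]; split.
    { intros H; apply HD0; rewrite H; apply le_refl. }
    exists E, U', V; split; [apply le_antisym; [exact HE | apply le_0_l]|].
    split; [apply sat_is_add, HS|]; split.
    - apply HP with U'; auto.
    - apply HP with U; auto. }
  destruct (difference (x + 1) U U' HU HU' Hne) as [HD|HD];
    [destruct (Hgoal U' U) as (U0 & HU0 & D & HD0 & HDn & G); auto
    |destruct (Hgoal U U') as (U0 & HU0 & D & HD0 & HDn & G); auto];
    exists U0; (split; [exact HU0|]); exists D; (split; [exact HD0|]);
    (split; [exact HDn|]);
    destruct G as (E' & W & V' & G1 & G2 & G3 & G4); exists E', W, V';
    (split; [exact G1|]); (split; [exact G2|]);
    (split; rewrite sat_subst; [exact G3 | exact G4]).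
Qed.

End InStructure.

Theorem theorem6 (phi : fm) (hphi : SigmaB0 phi) : provable W11 (ID phi).
Proof.
  apply completeness; intros M HM e1 e2 e3.
  (* The given assignment shows that every sort is inhabited and supplies the default elements. *)
  exact (sat_ID M (e1 0) (e2 0) (e3 0) HM phi e1 e2 e3 hphi).
Qed.
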